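(* Let $\epsilon>0$ be fixed. There is a constant $C_\epsilon$ such that the following holds: given a zero-sum labeling $c:E(K_n)\to\{-1,1\}$ of the complete graph $K_n$ and a spanning forest $F$ of $K_n$ of maximum degree $\Delta$, one can determine in polynomial time an isomorphic copy $F'$ of $F$ in $K_n$ (i.e. a subgraph $F'$ of $K_n$ isomorphic to $F$) with $$|c(E(F'))|\leq \left(\frac{3}{4}+\epsilon\right)\Delta+C_\epsilon.$$
   Context: $K_n$ denotes the complete graph on $n$ vertices. A labeling $c:E(K_n)\to\{-1,1\}$ is called zero-sum if $c(E(K_n))=\sum_{e\in E(K_n)}c(e)=0$. For a set $E$ of edges, $c(E)=\sum_{e\in E}c(e)$. ''Polynomial time'' refers to running time polynomial in $n$. *)

(* Defs.v *)
From mathcomp Require Import all_boot all_order all_fingroup all_algebra.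
From mathcomp Require Import reals.

Set Implicit Arguments.
Unset Strict Implicit.
Unset Printing Implicit Defensive.

Import Order.TTheory GRing.Theory Num.Theory.
Local Open Scope ring_scope.

(** * Spanning subgraphs of the complete graph on ['I_n]

    A spanning subgraph is given by its edge set, an edge being a 2-element set
    of vertices; its vertex set is always the whole of ['I_n]. *)

Definition complete_edges (n : nat) : {set {set 'I_n}} :=
  [set e : {set 'I_n} | #|e| == 2].

Definition weight (n : nat) (c : {set 'I_n} -> int) (E : {set {set 'I_n}}) : int :=
  \sum_(e in E) c e.

(** The values of [c] outside of [complete_edges n] are irrelevant. *)
Definition zero_sum_labeling (n : nat) (c : {set 'I_n} -> int) : Prop :=
  (forall e, e \in complete_edges n -> c e = -1 \/ c e = 1)
  /\ weight c (complete_edges n) = 0.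

Definition adj (n : nat) (F : {set {set 'I_n}}) : rel 'I_n :=
  fun u v => [set u; v] \in F.

(** A [ucycle] of size at most 2 is empty or a single edge traversed back and
    forth, hence not a cycle of the graph. *)
Definition acyclic (n : nat) (F : {set {set 'I_n}}) : Prop :=
  forall p : seq 'I_n, ucycle (adj F) p -> (size p <= 2)%N.

Definition spanning_forest (n : nat) (F : {set {set 'I_n}}) : Prop :=
  F \subset complete_edges n /\ acyclic F.

Definition max_degree (n : nat) (F : {set {set 'I_n}}) : nat :=
  (\max_(v : 'I_n) #|[set e in F | v \in e]|)%N.

(** A subgraph of the complete graph isomorphic to a spanning one is itself
    spanning, so isomorphisms are permutations of ['I_n]. *)
Definition isomorphic_copy (n : nat) (F F' : {set {set 'I_n}}) : Prop :=
  F' \subset complete_edges n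
  /\ exists s : {perm 'I_n}, forall u v, adj F' (s u) (s v) = adj F u v.

(** * Random access machine

    The machine is programmed by while-programs acting on arrays of natural
    numbers, with computed indices. A program names its arrays by constants, so
    that it uses finitely many of them, and scalar variables are entries of
    arrays. Every node of an evaluated expression and every executed statement
    costs one time unit. The only operations on numbers are addition and
    truncated subtraction: since a unit of time adds at most one bit to the
    largest number in memory, this unit-cost measure is polynomially related to
    the running time of Turing machines (with unit-cost multiplication, it would
    not be). *)

Definition memory := nat -> nat -> nat.

Definition update (m : memory) (a i x : nat) : memory :=
  fun b j => if (b == a) && (j == i) then x else m b j.

Inductive expr : Type :=
| Const of nat
| Read of nat & expr
| Add of expr & expr
| Sub of expr & expr.

Fixpoint eval (m : memory) (e : expr) : nat :=
  match e with
  | Const k => k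
  | Read a e1 => m a (eval m e1)
  | Add e1 e2 => (eval m e1 + eval m e2)%N
  | Sub e1 e2 => (eval m e1 - eval m e2)%N
  end.

Fixpoint cost (e : expr) : nat :=
  match e with
  | Const _ => 1%N
  | Read _ e1 => (cost e1).+1
  | Add e1 e2 => (cost e1 + cost e2).+1
  | Sub e1 e2 => (cost e1 + cost e2).+1
  end.

(** [Assign a e1 e2] is the assignment a[e1] := e2; [If] and [While] test whether
    their guard is nonzero. *)
Inductive program : Type :=
| Skip
| Assign of nat & expr & expr
| Seq of program & program
| If of expr & program & program
| While of expr & program.

(** [exec P m t m']: started in memory [m], the program [P] halts after exactly
    [t] time units in memory [m']. *)
Inductive exec : program -> memory -> nat -> memory -> Prop :=
| ExecSkip m : exec Skip m 1 m
| ExecAssign m a e1 e2 :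
    exec (Assign a e1 e2) m (cost e1 + cost e2).+1
      (update m a (eval m e1) (eval m e2))
| ExecSeq P Q m m1 m2 t1 t2 :
    exec P m t1 m1 -> exec Q m1 t2 m2 -> exec (Seq P Q) m (t1 + t2)%N m2
| ExecIfTrue e P Q m m1 t :
    eval m e <> 0%N -> exec P m t m1 -> exec (If e P Q) m (cost e + t).+1 m1
| ExecIfFalse e P Q m m1 t :
    eval m e = 0%N -> exec Q m t m1 -> exec (If e P Q) m (cost e + t).+1 m1
| ExecWhileEnd e P m :
    eval m e = 0%N -> exec (While e P) m (cost e).+1 m
| ExecWhileStep e P m m1 m2 t1 t2 :
    eval m e <> 0%N -> exec P m t1 m1 -> exec (While e P) m1 t2 m2 ->
    exec (While e P) m (cost e + t1 + t2).+1 m2.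

(** * Input and output of graphs *)

(** The array whose entry [i * n + j], for [i, j < n], is 1 if [r i j] holds;
    all other entries are 0. *)
Definition row_major (n : nat) (r : rel 'I_n) : nat -> nat :=
  fun k => [exists i : 'I_n, exists j : 'I_n, (k == i * n + j)%N && r i j].

(** Array 0 holds [n] at index 0, array 1 the matrix of the edges labeled 1 and
    array 2 the adjacency matrix of [F]; the rest of the memory is zero. *)
Definition input (n : nat) (c : {set 'I_n} -> int) (F : {set {set 'I_n}}) : memory :=
  fun a =>
    match a with
    | 0 => fun i => if i == 0%N then n else 0%N
    | 1 => row_major (fun u v => (u != v) && (c [set u; v] == 1))
    | 2 => row_major (adj F)
    | _ => fun _ => 0%N
    end.

(** The output is the adjacency matrix left in array 3; entries beyond the
    matrix are ignored. *)
Definition outputs (n : nat) (m : memory) (F : {set {set 'I_n}}) : Prop :=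
  forall u v : 'I_n, m 3%N (u * n + v)%N = adj F u v.

(** [P] computes in time polynomial in [n], from each zero-sum labeling [c] of the
    complete graph on [n] vertices and each spanning forest [F] of it, an
    isomorphic copy [F'] of [F] such that [good c F F']. The bound on the running
    time is uniform in [n], [c] and [F]. *)
Definition finds_copy_in_polynomial_time (P : program)
    (good : forall n : nat, ({set 'I_n} -> int) ->
            {set {set 'I_n}} -> {set {set 'I_n}} -> Prop) : Prop :=
  exists T : {poly nat},
  forall (n : nat) (c : {set 'I_n} -> int) (F : {set {set 'I_n}}),
    zero_sum_labeling c -> spanning_forest F ->
    exists (t : nat) (m : memory) (F' : {set {set 'I_n}}),
      [/\ exec P (input c F) t m, (t <= T.[n])%N, outputs m F',
          isomorphic_copy F F' & good n c F F'].

(* Main.v *)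
(** Embed the vertices of [F] one at a time, in such a way that the expected weight
    of a uniformly random completion of the partial embedding, which is initially 0,
    stays between -B and B for B = 3/4 Delta + O(1). The expectation is a martingale:
    averaged over the vertices to which the next vertex can be mapped, its new value
    is the old one. The greedy choice of an image minimizing its absolute value is
    hence good enough whenever the new value depends by at most B on the choice.
    This is the case while only small vertices, of degree at most Delta / 8, are left,
    and so these are embedded last.

    There are few large vertices, and they are embedded in an order in which each has
    at most one neighbor before it (the reverse of an order in which leaves are
    removed). While they are being embedded, mapping a vertex with d neighbors to u
    changes the expectation by about d t(u), where t(u) is the mean label at u among
    the free vertices, and the mean of t is about 0. If no choice of u were good,
    then the values of t would leave a gap of length about 3/2. The labels between
    the vertices above and those below the gap cancel in the difference of the sums
    of t above and below, which is therefore too small for such a gap. *)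

Require Import Defs.
From mathcomp Require Import all_boot all_order all_fingroup all_algebra.
From mathcomp Require Import reals.
From mathcomp Require Import zify ring lra.

Set Implicit Arguments.
Unset Strict Implicit.
Unset Printing Implicit Defensive.

Import Order.TTheory GRing.Theory Num.Theory.
Local Open Scope ring_scope.

(** * A language with bounded sums and loops *)

(** All iteration is bounded by [n], so a polynomial bound on the running time can be read off the
    syntax. *)
Inductive xexpr : Type :=
| XConst of nat
| XVar of nat
| XRead of nat & xexpr
| XAdd of xexpr & xexpr
| XSub of xexpr & xexpr
| XIf of xexpr & xexpr & xexpr
| XSum of nat & xexpr.

Definition bind (s : nat -> nat) (x j : nat) : nat -> nat :=
  fun y => if y == x then j else s y.

Fixpoint den (n : nat) (m : memory) (s : nat -> nat) (e : xexpr) : nat :=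
  match e with
  | XConst k => k
  | XVar x => s x
  | XRead a e1 => m a (den n m s e1)
  | XAdd e1 e2 => (den n m s e1 + den n m s e2)%N
  | XSub e1 e2 => (den n m s e1 - den n m s e2)%N
  | XIf e1 e2 e3 => if den n m s e1 != 0%N then den n m s e2 else den n m s e3
  | XSum x e1 => (\sum_(j < n) den n m (bind s x j) e1)%N
  end.

Inductive stmt : Type :=
| SAssign of nat & xexpr & xexpr
| SSeq of stmt & stmt
| SFor of nat & stmt.

Fixpoint sden (n : nat) (p : stmt) (s : nat -> nat) (m : memory) : memory :=
  match p with
  | SAssign a e1 e2 => update m a (den n m s e1) (den n m s e2)
  | SSeq p1 p2 => sden n p2 s (sden n p1 s m)
  | SFor x p1 => iteri n (fun j => sden n p1 (bind s x j)) m
  end.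

(* Array [vars] holds the values of the bound variables, array [regs] is a stack
   of intermediate results. *)
Definition regs := 4%N.
Definition vars := 5%N.
Definition private (a : nat) : bool := (a == regs) || (a == vars).

Definition for_loop (x : nat) (body : program) : program :=
  Seq (Assign vars (Const x) (Const 0))
    (While (Defs.Sub (Read 0 (Const 0)) (Read vars (Const x)))
      (Seq body (Assign vars (Const x) (Add (Read vars (Const x)) (Const 1))))).

Definition reg (q : nat) : expr := Read regs (Const q).

(** The value is left in register [q]; the registers below [q] are kept, those above are scratch
    space. *)
Fixpoint comp (q : nat) (e : xexpr) : program :=
  match e with
  | XConst k => Assign regs (Const q) (Const k)
  | XVar x => Assign regs (Const q) (Read vars (Const x))
  | XRead a e1 => Seq (comp q e1) (Assign regs (Const q) (Read a (reg q)))
  | XAdd e1 e2 => Seq (comp q e1) (Seq (comp q.+1 e2)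
      (Assign regs (Const q) (Add (reg q) (reg q.+1))))
  | XSub e1 e2 => Seq (comp q e1) (Seq (comp q.+1 e2)
      (Assign regs (Const q) (Defs.Sub (reg q) (reg q.+1))))
  | XIf e1 e2 e3 => Seq (comp q e1) (If (reg q) (comp q e2) (comp q e3))
  | XSum x e1 => Seq (Assign regs (Const q) (Const 0))
      (for_loop x (Seq (comp q.+1 e1)
        (Assign regs (Const q) (Add (reg q) (reg q.+1)))))
  end.

Fixpoint scomp (p : stmt) : program :=
  match p with
  | SAssign a e1 e2 =>
      Seq (comp 0 e1) (Seq (comp 1 e2) (Assign a (reg 0) (reg 1)))
  | SSeq p1 p2 => Seq (scomp p1) (scomp p2)
  | SFor x p1 => for_loop x (scomp p1)
  end.

(* [bs] lists the bound variables in scope; they may not be bound again. *)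
Fixpoint wf (bs : seq nat) (e : xexpr) : bool :=
  match e with
  | XConst _ => true
  | XVar x => x \in bs
  | XRead a e1 => ~~ private a && wf bs e1
  | XAdd e1 e2 | XSub e1 e2 => wf bs e1 && wf bs e2
  | XIf e1 e2 e3 => [&& wf bs e1, wf bs e2 & wf bs e3]
  | XSum x e1 => (x \notin bs) && wf (x :: bs) e1
  end.

(** Compiled loops reread their bound [n] from array 0 in every round, so nothing may be written
    there. *)
Fixpoint swf (bs : seq nat) (p : stmt) : bool :=
  match p with
  | SAssign a e1 e2 => [&& a != 0%N, ~~ private a, wf bs e1 & wf bs e2]
  | SSeq p1 p2 => swf bs p1 && swf bs p2
  | SFor x p1 => (x \notin bs) && swf (x :: bs) p1
  end.

Definition loop_time (T : {poly nat}) : {poly nat} := 20%:P + 'X * (T + 20%:P).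

(** Only an upper bound, with generous constants; the two branches of [XIf] are added since
    polynomials have no maximum. *)
Fixpoint time (e : xexpr) : {poly nat} :=
  match e with
  | XConst _ | XVar _ => 10%:P
  | XRead a e1 => time e1 + 10%:P
  | XAdd e1 e2 | XSub e1 e2 => time e1 + (time e2 + 10%:P)
  | XIf e1 e2 e3 => time e1 + (time e2 + time e3 + 10%:P)
  | XSum x e1 => 10%:P + loop_time (time e1 + 10%:P)
  end.

Fixpoint stime (p : stmt) : {poly nat} :=
  match p with
  | SAssign a e1 e2 => time e1 + (time e2 + 10%:P)
  | SSeq p1 p2 => stime p1 + stime p2
  | SFor x p1 => loop_time (stime p1)
  end.

(** * Correctness and running time of compiled programs, by Hoare triples with a time budget *)

Definition runs (P : program) (m : memory) (T : nat) (Q : memory -> Prop) : Prop :=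
  exists t m', [/\ exec P m t m', (t <= T)%N & Q m'].

Lemma runs_weaken P m T T' (Q Q' : memory -> Prop) :
  runs P m T Q -> (T <= T')%N -> (forall m', Q m' -> Q' m') -> runs P m T' Q'.
Proof.
move=> [t [m' [ex le_tT Qm']]] leT QQ'; exists t, m'; split=> //; last exact: QQ'.
exact: leq_trans leT.
Qed.

Lemma runs_seq P1 P2 m T1 T2 Q :
  runs P1 m T1 (fun m1 => runs P2 m1 T2 Q) -> runs (Seq P1 P2) m (T1 + T2) Q.
Proof.
move=> [t1 [m1 [ex1 le1 [t2 [m2 [ex2 le2 Qm2]]]]]].
exists (t1 + t2)%N, m2; split=> //; first exact: ExecSeq ex1 ex2.
exact: leq_add.
Qed.

Lemma runs_assign a e1 e2 m T (Q : memory -> Prop) :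
  (cost e1 + cost e2 < T)%N -> Q (update m a (eval m e1) (eval m e2)) ->
  runs (Assign a e1 e2) m T Q.
Proof. by move=> leT Qm; eexists _, _; split; [exact: ExecAssign| |]. Qed.

Lemma runs_for (n x : nat) body m T (I : nat -> memory -> Prop) :
  m 0%N 0%N = n -> I 0%N (update m vars x 0) ->
  (forall j m1, (j < n)%N -> m1 0%N 0%N = n -> m1 vars x = j -> I j m1 ->
     runs body m1 T (fun m2 => [/\ m2 0%N 0%N = n, m2 vars x = j &
                                  I j.+1 (update m2 vars x j.+1)])) ->
  runs (for_loop x body) m (20 + n * (T + 20)) (I n).
Proof.
move=> mn I0 step.
(* Induction on the number [k] of rounds left; 10 pays for the final test, and 20 for the test and
   the increment in each round. *)
suff loop k : forall j m1, (j + k)%N = n -> m1 0%N 0%N = n -> m1 vars x = j ->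
    I j m1 ->
    runs (While (Defs.Sub (Read 0 (Const 0)) (Read vars (Const x)))
       (Seq body (Assign vars (Const x) (Add (Read vars (Const x)) (Const 1)))))
     m1 (10 + k * (T + 20)) (I n).
  rewrite -[20%N]/(10 + 10)%N -addnA.
  apply: runs_seq; apply: runs_assign => //=.
  by apply: (loop _ 0%N) => //=; rewrite /update /= ?eqxx.
elim: k => [|k IHk] j m1 jk m1n m1x Ij.
  eexists _, m1; split; first by apply: ExecWhileEnd; rewrite /= m1n m1x; lia.
    by [].
  by rewrite -jk addn0.
have lt_jn : (j < n)%N by lia.
have [t1 [m2 [ex1 le1 [m2n m2x Ij1]]]] := step j m1 lt_jn m1n m1x Ij.
have [||||t2 [m3 [ex2 le2 Qm3]]] := IHk j.+1 (update m2 vars x j.+1).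
- by lia.
- by [].
- by rewrite /update !eqxx.
- by [].
exists (5 + (t1 + 6) + t2).+1, m3; split=> //.
  apply: (ExecWhileStep (m1 := update m2 vars x j.+1)); first by rewrite /= m1n m1x; lia.
    apply: ExecSeq ex1 _.
    have := ExecAssign m2 vars (Const x) (Add (Read vars (Const x)) (Const 1)).
    by rewrite /= m2x (addn1 j).
  exact: ex2.
by lia.
Qed.

(** The frame condition of an evaluation into register [q] while the variables [bs] are in scope. *)
Definition same (bs : seq nat) (q : nat) (m m' : memory) : Prop :=
  [/\ forall a, ~~ private a -> m' a =1 m a,
      forall i, (i < q)%N -> m' regs i = m regs i &
      forall x, x \in bs -> m' vars x = m vars x].

Lemma same_trans bs q m1 m2 m3 :
  same bs q m1 m2 -> same bs q m2 m3 -> same bs q m1 m3.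
Proof.
move=> [a1 b1 c1] [a2 b2 c2]; split=> [a pa i|i lti|x xbs].
- by rewrite a2 // a1.
- by rewrite b2 // b1.
- by rewrite c2 // c1.
Qed.

Lemma sameW bs q x m m' : same (x :: bs) q.+1 m m' -> same bs q m m'.
Proof.
move=> [a b c]; split=> // [i lti|y yb]; first by apply: b; lia.
by apply: c; rewrite inE yb orbT.
Qed.

Lemma sameWq bs q m m' : same bs q.+1 m m' -> same bs q m m'.
Proof. by move=> [a b c]; split=> // i lti; apply: b; lia. Qed.

Lemma same_regs bs q m k : same bs q m (update m regs q k).
Proof.
split=> [a|i lti|x xb]; rewrite /update /=.
- by rewrite /private negb_or => /andP[/negbTE-> _].
- by case: eqP => //; lia.
- by [].
Qed.

Lemma same_vars bs q m x k : x \notin bs -> same bs q m (update m vars x k).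
Proof.
move=> xb; split=> [a|i lti|y yb]; rewrite /update /=.
- by rewrite /private negb_or => /andP[_ /negbTE->].
- by [].
- by case: eqP => // E; rewrite -E yb in xb.
Qed.

Lemma den_ext n bs e : forall m m' s s', wf bs e ->
  (forall a, ~~ private a -> m' a =1 m a) -> {in bs, s' =1 s} ->
  den n m' s' e = den n m s e.
Proof.
elim: e bs => [k|x|a e IH|e1 IH1 e2 IH2|e1 IH1 e2 IH2|e1 IH1 e2 IH2 e3 IH3|x e IH]
  bs m m' s s' /=.
- by [].
- by move=> xb _ ss; apply: ss.
- by case/andP=> pa we mm ss; rewrite (IH _ _ _ _ _ we mm ss) mm.
- by case/andP=> w1 w2 mm ss; rewrite (IH1 _ _ _ _ _ w1 mm ss) (IH2 _ _ _ _ _ w2 mm ss).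
- by case/andP=> w1 w2 mm ss; rewrite (IH1 _ _ _ _ _ w1 mm ss) (IH2 _ _ _ _ _ w2 mm ss).
- case/and3P=> w1 w2 w3 mm ss.
  by rewrite (IH1 _ _ _ _ _ w1 mm ss) (IH2 _ _ _ _ _ w2 mm ss) (IH3 _ _ _ _ _ w3 mm ss).
- case/andP=> xb we mm ss; apply: eq_bigr => j _.
  apply: (IH _ _ _ _ _ we mm) => y; rewrite inE /bind.
  by case: eqP => //= _; apply: ss.
Qed.

Lemma comp_correct n e : forall bs q m, wf bs e -> m 0%N 0%N = n ->
  runs (comp q e) m (time e).[n]
    (fun m' => same bs q m m' /\ m' regs q = den n m (m vars) e).
Proof.
elim: e => [k|x|a e IH|e1 IH1 e2 IH2|e1 IH1 e2 IH2|e1 IH1 e2 IH2 e3 IH3|x e IH]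
  bs q m /=.
- move=> _ mn; rewrite hornerC; apply: runs_assign => //=; split; first exact: same_regs.
  by rewrite /update !eqxx.
- move=> _ mn; rewrite hornerC; apply: runs_assign => //=; split; first exact: same_regs.
  by rewrite /update !eqxx.
- case/andP=> pa we mn; rewrite hornerD hornerC; apply: runs_seq.
  apply: runs_weaken (IH bs q m we mn) (leqnn _) _ => m1 [sm1 m1q].
  apply: runs_assign => //=; split; first exact: same_trans sm1 (same_regs _ _ _ _).
  rewrite /update !eqxx m1q; by case: sm1 => ->.
- case/andP=> w1 w2 mn; rewrite !hornerD hornerC; apply: runs_seq.
  apply: runs_weaken (IH1 bs q m w1 mn) (leqnn _) _ => m1 [sm1 m1q].
  have m1n : m1 0%N 0%N = n by case: sm1 => ->.
  apply: runs_seq; apply: runs_weaken (IH2 bs q.+1 m1 w2 m1n) (leqnn _) _.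
  move=> m2 [sm2 m2q].
  apply: runs_assign => //=; split.
    apply: same_trans sm1 _; apply: same_trans (same_regs _ _ _ _).
    exact: sameWq.
  rewrite /update !eqxx m2q; case: sm2 => _ -> // _; rewrite m1q.
  by congr addn; case: sm1 => sa _ sc; apply: den_ext w2 sa sc.
- case/andP=> w1 w2 mn; rewrite !hornerD hornerC; apply: runs_seq.
  apply: runs_weaken (IH1 bs q m w1 mn) (leqnn _) _ => m1 [sm1 m1q].
  have m1n : m1 0%N 0%N = n by case: sm1 => ->.
  apply: runs_seq; apply: runs_weaken (IH2 bs q.+1 m1 w2 m1n) (leqnn _) _.
  move=> m2 [sm2 m2q].
  apply: runs_assign => //=; split.
    apply: same_trans sm1 _; apply: same_trans (same_regs _ _ _ _).
    exact: sameWq.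
  rewrite /update !eqxx m2q; case: sm2 => _ -> // _; rewrite m1q.
  by congr subn; case: sm1 => sa _ sc; apply: den_ext w2 sa sc.
- case/and3P=> w1 w2 w3 mn; rewrite !hornerD hornerC; apply: runs_seq.
  apply: runs_weaken (IH1 bs q m w1 mn) (leqnn _) _ => m1 [sm1 m1q].
  have m1n : m1 0%N 0%N = n by case: sm1 => ->.
  have [sa _ sc] := sm1.
  case: (eqVneq (m1 regs q) 0%N) => [c0|c1].
    have [t [m2 [ex2 le2 [sm2 m2q]]]] := IH3 bs q m1 w3 m1n.
    eexists _, m2; split; first by apply: ExecIfFalse ex2.
      rewrite /= -[(_ + 10)%R]/(_ + 10)%N -[(_ + _)%R]/(_ + _)%N; lia.
    split; first exact: same_trans sm2.
    by rewrite -m1q c0 m2q; apply: den_ext w3 sa sc.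
  have [t [m2 [ex2 le2 [sm2 m2q]]]] := IH2 bs q m1 w2 m1n.
  eexists _, m2; split; first by apply: ExecIfTrue ex2; apply/eqP.
    rewrite /= -[(_ + 10)%R]/(_ + 10)%N -[(_ + _)%R]/(_ + _)%N; lia.
  split; first exact: same_trans sm2.
  by rewrite -m1q c1 m2q; apply: den_ext w2 sa sc.
- case/andP=> xb we mn.
  rewrite /loop_time !hornerD hornerM !hornerD !hornerC hornerX.
  apply: runs_seq; apply: runs_assign => //=.
  set m0 := update _ _ _ _.
  have sm0 : same bs q m m0 by exact: same_regs.
  (* Loop invariant: register [q] accumulates the partial sum, while the summands are evaluated in
     register [q.+1]. *)
  pose I j (m1 : memory) := same bs q m m1 /\
    m1 regs q = (\sum_(i < n | (i < j)%N) den n m (bind (m vars) x i) e)%N.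
  apply: (runs_weaken (T := (20 + n * ((time e).[n] + 10 + 20))%N)
            (@runs_for n x _ m0 _ I _ _ _)).
  + by [].
  + split; first by apply: same_trans sm0 _; exact: same_vars.
    rewrite big_pred0; last by []. rewrite /m0 /update /=. by rewrite eqxx.
  + move=> j m1 jn m1n m1x [sm1 m1q]; apply: runs_seq.
    apply: runs_weaken (IH (x :: bs) q.+1 m1 we m1n) (leqnn _) _ => m2 [sm2 m2q].
    have [sa1 _ sc1] := sm1; have [sa2 sb2 sc2] := sm2.
    apply: runs_assign => //=.
    split; rewrite /update /=.
    * by rewrite sa2.
    * by rewrite sc2 // inE eqxx.
    split.
      apply: same_trans sm1 _; apply: (same_trans (sameW sm2)).
      by apply: same_trans (same_regs bs q _ _) _; exact: same_vars.
    rewrite /= !eqxx /= m2q sb2 // m1q [RHS](bigD1 (Ordinal jn)) //= addnC.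
    congr addn.
      apply: den_ext we sa1 _ => y; rewrite inE /bind.
      by case: eqP => //= [->|_ yb] //; exact: sc1.
    apply: eq_bigl => i; rewrite -val_eqE /=; lia.
  + by [].
  + move=> m' [sm' m'q]; split=> //; rewrite m'q.
    by apply: eq_bigl => i; rewrite ltn_ord.
Qed.

Lemma sden_n n p : forall bs s m, swf bs p -> sden n p s m 0%N = m 0%N.
Proof.
elim: p => [a e1 e2|p1 IH1 p2 IH2|x p IH] bs s m /=.
- by case/and4P=> /negbTE a0 _ _ _; rewrite /update eq_sym a0.
- by case/andP=> w1 w2; rewrite (IH2 bs) ?(IH1 bs).
- case/andP=> _ w; elim: {1}n => //= k IHk.
  by rewrite (IH _ _ _ w).
Qed.

Lemma sden_ext n p : forall bs s s' m, swf bs p -> {in bs, s' =1 s} ->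
  sden n p s' m = sden n p s m.
Proof.
elim: p => [a e1 e2|p1 IH1 p2 IH2|x p IH] bs s s' m /=.
- case/and4P=> _ _ w1 w2 ss.
  by rewrite (den_ext n w1 (m := m) (s := s)) // (den_ext n w2 (m := m) (s := s)).
- by case/andP=> w1 w2 ss; rewrite (IH1 _ _ _ _ w1 ss) (IH2 _ _ _ _ w2 ss).
- case/andP=> xb w ss; elim: {1 3}n => //= k ->.
  apply: (IH _ _ _ _ w) => y; rewrite inE /bind.
  by case: eqP => //= _; apply: ss.
Qed.

(** The memory [M] is an idealized one without temporaries: it is compared with the machine memory
    [m] only outside of the private arrays, and the variables are taken from [m]. *)
Lemma scomp_correct n p : forall bs m M, swf bs p -> M 0%N 0%N = n ->
  (forall a, ~~ private a -> m a =1 M a) ->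
  runs (scomp p) m (stime p).[n]
    (fun m' => (forall a, ~~ private a -> m' a =1 sden n p (m vars) M a)
               /\ {in bs, m' vars =1 m vars}).
Proof.
elim: p => [a e1 e2|p1 IH1 p2 IH2|x p IH] bs m M /=.
- case/and4P=> a0 pa w1 w2 Mn mM; have mn : m 0%N 0%N = n by rewrite mM.
  rewrite !hornerD hornerC; apply: runs_seq.
  apply: runs_weaken (comp_correct 0 w1 mn) (leqnn _) _ => m1 [sm1 m1q].
  have m1n : m1 0%N 0%N = n by case: sm1 => ->.
  have [sa1 _ sc1] := sm1.
  apply: runs_seq; apply: runs_weaken (comp_correct 1 w2 m1n) (leqnn _) _.
  move=> m2 [[sa2 sb2 sc2] m2q]; apply: runs_assign => //=.
  split=> [b pb i|y yb]; rewrite /update.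
    rewrite sb2 // m1q m2q.
    rewrite -(den_ext (s' := m vars) n w1 mM) // (den_ext (m := M) (s := m vars) n w2) //.
      by case: ifP => // _; rewrite sa2 // sa1 // mM.
    by move=> b' pb' k; rewrite sa1 // mM.
  move: pa; rewrite /private negb_or [_ == a]eq_sym => /andP[_ /negbTE->] /=.
  by rewrite sc2 // sc1.
- case/andP=> w1 w2 Mn mM; rewrite hornerD; apply: runs_seq.
  apply: runs_weaken (IH1 bs m M w1 Mn mM) (leqnn _) _ => m1 [sm1 sv1].
  have Mn1 : sden n p1 (m vars) M 0%N 0%N = n by rewrite (sden_n _ _ _ w1).
  apply: runs_weaken (IH2 bs m1 _ w2 Mn1 sm1) (leqnn _) _ => m2 [sm2 sv2].
  split=> [a pa i|y yb]; last by rewrite sv2 // sv1.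
  by rewrite sm2 // (sden_ext n _ w2 sv1).
- case/andP=> xb w Mn mM; have mn : m 0%N 0%N = n by rewrite mM.
  rewrite /loop_time !hornerD hornerM !hornerD !hornerC hornerX.
  pose M_ j := iteri j (fun j => sden n p (bind (m vars) x j)) M.
  pose I j (m1 : memory) := (forall a, ~~ private a -> m1 a =1 M_ j a)
                         /\ {in bs, m1 vars =1 m vars}.
  apply: (runs_weaken (T := (20 + n * ((stime p).[n] + 20))%N)
            (@runs_for n x _ m _ I mn _ _)).
  + have [sa _ sc] := same_vars 0 m 0 xb; split=> // a pa i.
    by rewrite sa // mM.
  + move=> j m1 jn m1n m1x [m1M m1v].
    have Mjn : M_ j 0%N 0%N = n by rewrite -m1M.
    apply: runs_weaken (IH _ m1 _ w Mjn m1M) (leqnn _) _ => m2 [m2M m2v].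
    have m2x : m2 vars x = j by rewrite m2v ?inE ?eqxx.
    split=> //.
      by rewrite m2M // (sden_n _ _ _ w) -m1M.
    have [sa _ sc] := same_vars 0 m2 j.+1 xb; split=> [a pa i|y yb].
      rewrite sa // m2M // /M_ /= -/(M_ j).
      rewrite (sden_ext (s := bind (m vars) x j) n _ w) // => y.
      rewrite inE /bind; case: eqP => [-> //|_ /= yb]; exact: m1v.
    by rewrite sc // m2v ?m1v // inE yb orbT.
  + by [].
  + by [].
Qed.

(** * Forests *)

Section Forest.

Variables (T : finType) (A : rel T).
Hypotheses (A_sym : symmetric A) (A_irr : irreflexive A).
Hypothesis A_acyclic : forall p : seq T, ucycle A p -> (size p <= 2)%N.

Definition deg_in (U : {set T}) (v : T) : nat := (\sum_(w in U) A v w)%N.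

Lemma deg_inE U v : deg_in U v = #|[set w in U | A v w]|.
Proof.
rewrite /deg_in -big_mkcondr /= sum1_card.
by apply: eq_card => w; rewrite !inE.
Qed.

(* Without a leaf a path could be prolonged forever. *)
Lemma forest_leaf (U : {set T}) : U != set0 -> exists2 v, v \in U & (deg_in U v <= 1)%N.
Proof.
case/set0Pn=> v0 v0U; apply/exists_inP; apply: contraT => /exists_inPn big_deg.
suff long k : exists x p, [/\ path A x p, uniq (x :: p), all [in U] (x :: p) & size p = k].
  have [x [p [_ + _ sz]]] := long #|T|; move/card_uniqP; rewrite /= sz => E.
  by have := max_card (mem (x :: p)); rewrite E ltnn.
elim: k => [|k [x [p [pth unq sub sz]]]]; first by exists v0, [::]; rewrite /= v0U.
have xU : x \in U by move: sub => /= /andP[].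
have [y [z [yU zU Ay Az neq]]] : exists y z, [/\ y \in U, z \in U, A x y, A x z & y != z].
  have := big_deg x xU; rewrite -ltnNge deg_inE.
  case/card_gt1P=> y [z [+ + neq]]; rewrite !inE => /andP[? ?] /andP[? ?].
  by exists y, z.
(* The path grows at its front [x], so [head x p] is the predecessor of [x], or [x] itself if the
   path is trivial; one of two neighbors avoids it. *)
have [w [wU Aw w_head]] : exists w, [/\ w \in U, A x w & w != head x p].
  have [E|nE] := eqVneq y (head x p); last by exists y.
  by exists z; rewrite -E eq_sym.
have wx : w != x by apply: contraTneq Aw => ->; rewrite A_irr.
have [wp|nwp] := boolP (w \in p); last first.
  exists w, (x :: p); rewrite /= A_sym Aw pth /= inE (negbTE wx) /= nwp sz wU.
  by move: unq sub => /= -> ->.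
(* A neighbor already on the path closes a cycle, of length at least 3 because it is not the
   predecessor of [x]. *)
case/splitPr: wp pth unq w_head {sub sz} => p1 p2 pth unq w_head.
have cyc : ucycle A (x :: rcons p1 w).
  apply/andP; split.
    rewrite /= rcons_path last_rcons -[A w x]A_sym Aw andbT.
    by move: pth; rewrite -cat_rcons cat_path => /andP[].
  by move: unq; rewrite /= -cat_rcons mem_cat cat_uniq negb_or => /andP[/andP[-> _] /andP[-> _]].
have := A_acyclic cyc; rewrite /= size_rcons.
by case: p1 {pth unq cyc} w_head => [|? ?] //=; rewrite eqxx.
Qed.

(** Removing a leaf, which exists by [forest_leaf], lowers the sum of the degrees by at most 2. *)
Lemma forest_edges (U : {set T}) : (\sum_(v in U) deg_in U v <= 2 * #|U|)%N.
Proof.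
have [k] := ubnP #|U|; elim: k U => // k IHk U ltU.
have [->|U0] := eqVneq U set0; first by rewrite big_set0.
have [v vU dv] := forest_leaf U0.
have card := cardsD1 v U; rewrite vU /= in card.
have {IHk} := IHk (U :\ v); rewrite card; move=> /(_ ltac:(lia)) IH.
have -> : (\sum_(w in U) deg_in U w = \sum_(w in U :\ v) deg_in (U :\ v) w + 2 * deg_in U v)%N.
  rewrite (big_setD1 v vU) /= mul2n -addnn addnA addnC; congr addn.
  transitivity (\sum_(w in U :\ v) (deg_in (U :\ v) w + A v w))%N.
    by apply: eq_bigr => w _; rewrite /deg_in (big_setD1 v vU) /= A_sym addnC.
  by rewrite big_split /= /deg_in [X in (_ = _ + X)%N](big_setD1 v vU) /= A_irr.
by lia.
Qed.

End Forest.

(** * The conditional expectation *)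

(* [p] and [q] are the fractions of vertices above and below the gap. *)
Lemma gap_arith (R : realFieldType) (p q a b : R) :
  0 < p -> 0 < q -> p + q = 1 -> a <= 1 -> b <= 1 -> 29 / 20 <= a + b ->
  a * p + b * q <= p ^+ 2 + q ^+ 2 -> a * p - q <= 40^-1 -> b * q - p <= 40^-1 -> False.
Proof.
wlog le_ab : p q a b / a <= b => [wlog|] p0 q0 pq a1 b1 ab E1 E2 E3.
  have [le_ab|/ltW le_ba] := leP a b; first exact: (wlog p q a b).
  by apply: (wlog q p b a) => //; lra.
have qE : q = 1 - p by lra.
have [p12|p12] := leP p (1 / 2).
  (* Here b >= 29/40, so [E3] gives p >= 2/5. As p <= q and a <= b, the left side of [E1] is at
     least (a + b) / 2 >= 29/40, but p^2 + q^2 <= 13/25. *)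
  have pge : 2 / 5 <= p by have := mulr_ge0 (_ : 0 <= b - 29 / 40) (ltW q0); nra.
  have : 29 / 40 <= p ^+ 2 + q ^+ 2.
    by apply: le_trans E1; rewrite qE; nra.
  by rewrite qE; nra.
(* For p > q the left side of [E1] is least at b = 1 and a = 9/20, where [E1] reads 29/20 p <= 2
   p^2. With a >= 9/20 such a [p] contradicts [E2]. *)
have pge : 29 / 40 <= p by rewrite qE in E1; nra.
by rewrite qE in E2; nra.
Qed.

Section Potential.

Variables (R : realFieldType) (T : finType) (A : rel T) (C : T -> T -> R).
Hypotheses (A_sym : symmetric A) (A_irr : irreflexive A).
Hypotheses (C_sym : forall x y, C x y = C y x) (C_irr : forall x, C x x = 0).
Hypothesis C_le1 : forall x y, `|C x y| <= 1.
Hypothesis A_sparse : forall U : {set T}, (\sum_(v in U) deg_in A U v <= 2 * #|U|)%N.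

Definition lab (X : {set T}) (x : T) : R := \sum_(y in X) C x y.

Definition out (S : {set T}) (s : T) : R := \sum_(w in ~: S) (A s w)%:R.

Definition inner (S : {set T}) (f : T -> T) : R :=
  \sum_(s in S) \sum_(t in S) (A s t)%:R * C (f s) (f t).

(* Twice the expected weight of the copy of the graph [A] under a uniformly random
   bijective extension of the injection [f] defined on [S]; terms with a zero
   denominator have a zero numerator. *)
Definition potential (S : {set T}) (f : T -> T) : R :=
  let X := ~: (f @: S) in let r := #|X|%:R in
  inner S f + 2 / r * (\sum_(s in S) out S s * lab X (f s))
  + (\sum_(w in ~: S) out S w) * (\sum_(x in X) lab X x) / (r * (r - 1)).

Lemma deg_inR (U : {set T}) v : (deg_in A U v)%:R = \sum_(w in U) (A v w)%:R :> R.
Proof. by rewrite /deg_in natr_sum. Qed.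

Lemma norm_lab (X : {set T}) x : `|lab X x| <= #|X|%:R.
Proof.
apply: le_trans (ler_norm_sum _ _ _) _; rewrite -sumr_const.
exact: ler_sum.
Qed.

Lemma norm_lab_in (X : {set T}) x : x \in X -> `|lab X x| <= #|X|%:R - 1.
Proof.
move=> xX; rewrite /lab (big_setD1 x xX) /= C_irr add0r (cardsD1 x) xX natrD addrAC subrr add0r.
exact: norm_lab.
Qed.

Lemma lab_setD1 (X : {set T}) x y : x \in X -> lab (X :\ x) y = lab X y - C y x.
Proof. by move=> xX; rewrite /lab (big_setD1 x xX) /= addrC addrK. Qed.

Lemma norm_wsum (I : finType) (P : pred I) (a b : I -> R) (M : R) :
  (forall i, P i -> 0 <= a i) -> (forall i, P i -> `|b i| <= M) ->
  `|\sum_(i | P i) a i * b i| <= (\sum_(i | P i) a i) * M.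
Proof.
move=> a0 bM; apply: le_trans (ler_norm_sum _ _ _) _; rewrite mulr_suml.
apply: ler_sum => i Pi; rewrite normrM ger0_norm ?a0 //.
by rewrite ler_wpM2l ?a0 ?bM.
Qed.

Lemma out_ge0 S s : 0 <= out S s.
Proof. by apply: sumr_ge0 => w _; rewrite ler0n. Qed.

(** * Extending a partial embedding by one vertex *)

Section Step.

Variables (S : {set T}) (f : T -> T) (v : T).
Hypotheses (f_inj : {in S &, injective f}) (vS : v \notin S).

(* If [v] is mapped to [u], then [p u] is the weight of the edges from [v] back to
   [S], whereas [q u] and [d * lab X u] correct the sums of the labels between [S']
   and the free vertices; [E'] is twice the number of edges outside of [S']. *)
Let X := ~: (f @: S).
Let r : R := #|X|%:R.
Let S' := v |: S.
Let p u := \sum_(s in S) (A s v)%:R * C (f s) u.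
Let q u := \sum_(s in S) out S' s * C (f s) u.
Let B0 := \sum_(s in S) out S' s * lab X (f s).
Let d := out S v.
Let E' := \sum_(w in ~: S') out S' w.
Let W := \sum_(x in X) lab X x.
Let back : R := \sum_(s in S) (A s v)%:R.
Let e := \sum_(s in S) out S' s.

Definition extend (u w : T) : T := if w == v then u else f w.

Let next u := potential S' (extend u).

Lemma card_free : #|X| = #|~: S|.
Proof.
have := cardsC (f @: S); have := cardsC S.
by rewrite card_in_imset // -/X => <- /eqP; rewrite eqn_add2l => /eqP.
Qed.

Lemma card_free_gt0 : (0 < #|X|)%N.
Proof. by rewrite card_free; apply/card_gt0P; exists v; rewrite inE. Qed.

Lemma card_free_next : #|X| = #|~: S'|.+1.
Proof.
rewrite card_free (cardsD1 v) !inE vS add1n; congr _.+1.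
by apply: eq_card => w; rewrite !inE negb_or.
Qed.

Lemma free_extend u : u \in X -> ~: (extend u @: S') = X :\ u.
Proof.
move=> uX; apply/setP=> x; rewrite !inE -negb_or; congr (~~ _).
apply/imsetP/orP => [[w]|].
  rewrite !inE /extend => /orP[/eqP->|wS]; first by rewrite eqxx => ->; left.
  case: eqP => [E|_ ->]; first by move: vS; rewrite -E wS.
  by right; apply: imset_f.
case=> [/eqP->|/imsetP[w wS ->]]; first by exists v; rewrite ?setU11 // /extend eqxx.
exists w; first by rewrite !inE wS orbT.
by rewrite /extend; case: eqP => // E; move: vS; rewrite -E wS.
Qed.

Lemma extend_inj u : u \in X -> {in S' &, injective (extend u)}.
Proof.
move=> uX; have uS w : w \in S -> u <> f w.
  by move=> wS E; move: uX; rewrite inE E imset_f.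
move=> w1 w2; rewrite !inE /extend.
case: eqP => [->|_] /=; case: eqP => [->|_] //=.
- by move=> _ /uS.
- by move=> /uS ne _ E; case: ne.
- exact: f_inj.
Qed.

Lemma extend_old u s : s \in S -> extend u s = f s.
Proof. by rewrite /extend; case: eqP => // ->; rewrite (negbTE vS). Qed.

Lemma extend_new u : extend u v = u.
Proof. by rewrite /extend eqxx. Qed.

Lemma setC_next : ~: S = v |: ~: S'.
Proof.
by apply/setP=> w; rewrite !inE negb_or; case: eqP => [->|]; rewrite ?vS.
Qed.

Lemma out_next s : out S s = (A s v)%:R + out S' s.
Proof. by rewrite /out setC_next big_setU1 //= !inE eqxx. Qed.

Lemma sum_out_next : \sum_(w in ~: S) out S w = E' + 2 * d.
Proof.
have vS'c : v \notin ~: S' by rewrite !inE eqxx.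
rewrite {1}setC_next big_setU1 //= -/d.
rewrite (eq_bigr (fun w => (A w v)%:R + out S' w)); last first.
  by move=> w _; rewrite out_next.
rewrite big_split /= -/E'.
have -> : \sum_(w in ~: S') (A w v)%:R = d.
  rewrite /d out_next A_irr add0r; apply: eq_bigr => w _; by rewrite A_sym.
ring.
Qed.

(** The edges at [v] are separated from the others, so that the quantities are those of
    [potential_next]. *)
Lemma potential_now :
  potential S f = inner S f + 2 / r * (B0 + \sum_(u in X) p u)
                  + (E' + 2 * d) * W / (r * (r - 1)).
Proof.
rewrite /potential sum_out_next -/X -/r -/W; congr (_ + 2 / r * _ + _).
rewrite [X in _ = B0 + X]exchange_big -big_split /=; apply: eq_bigr => s _.
by rewrite out_next mulrDl addrC -mulr_sumr.
Qed.

Lemma potential_next u : u \in X ->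
  next u = inner S f + 2 * p u + 2 / (r - 1) * (B0 - q u + d * lab X u)
           + E' * (W - 2 * lab X u) / ((r - 1) * (r - 2)).
Proof.
move=> uX; rewrite /next /potential free_extend //.
have -> : #|X :\ u|%:R = r - 1 by rewrite /r (cardsD1 u X) uX natrD addrAC subrr add0r.
have -> : inner S' (extend u) = inner S f + 2 * p u.
  rewrite /inner big_setU1 //= big_setU1 //= A_irr mul0r add0r.
  rewrite (eq_bigr (fun s => (A s v)%:R * C (f s) u)); last first.
    by move=> s sS; rewrite extend_new extend_old // A_sym C_sym.
  rewrite -/(p u).
  rewrite [X in _ + X](eq_bigr (fun s => (A s v)%:R * C (f s) u
      + \sum_(t in S) (A s t)%:R * C (f s) (f t))); last first.
    move=> s sS; rewrite big_setU1 //= extend_new extend_old //; congr (_ + _).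
    by apply: eq_bigr => t tS; rewrite extend_old.
  rewrite big_split /= -/(p u); ring.
have -> : \sum_(s in S') out S' s * lab (X :\ u) (extend u s) = B0 - q u + d * lab X u.
  rewrite big_setU1 //= extend_new lab_setD1 // C_irr subr0.
  have <- : d = out S' v by rewrite /d out_next A_irr add0r.
  rewrite addrC; congr (_ + _); rewrite /B0 /q -sumrB; apply: eq_bigr => s sS.
  by rewrite extend_old // lab_setD1 // mulrBr.
(* Both the row and the column of [u] leave the double sum. *)
have -> : \sum_(x in X :\ u) lab (X :\ u) x = W - 2 * lab X u.
  rewrite (eq_bigr (fun x => lab X x - C x u)); last by move=> x _; rewrite lab_setD1.
  rewrite sumrB /W (big_setD1 u uX) /=.
  have -> : \sum_(x in X :\ u) C x u = lab X u.
    rewrite /lab (big_setD1 u uX) /= C_irr add0r; apply: eq_bigr => x _; exact: C_sym.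
  ring.
rewrite -/E'; congr (_ + _ / (_ * _)); ring.
Qed.

Lemma sum_q : \sum_(u in X) q u = B0.
Proof.
rewrite /q exchange_big /=; apply: eq_bigr => s _; by rewrite -mulr_sumr.
Qed.

Lemma next_small_E' : (#|X| <= 2)%N -> E' = 0.
Proof.
rewrite card_free_next ltnS => le1; rewrite /E' big1 // => w wS'.
rewrite /out big1 // => w' w'S'.
have -> : w' = w by apply: (card_le1_eqP le1).
by rewrite A_irr.
Qed.

Lemma next_last : #|X| = 1%N -> [/\ B0 = 0, W = 0 & d = 0].
Proof.
move=> X1; have := card_free_next; rewrite X1 => -[/esym/eqP].
rewrite cards_eq0 => /eqP S'c.
have out0 s : out S' s = 0 by rewrite /out S'c big_set0.
have /cards1P[u Xu] : #|X| == 1%N by rewrite X1.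
split.
- by rewrite /B0 big1 // => s _; rewrite out0 mul0r.
- by rewrite /W /lab Xu big_set1 big_set1 C_irr.
- by rewrite /d out_next A_irr out0 addr0.
Qed.

(** This is the martingale property. It is an identity of rational functions, once the terms with
    labels at [u] have been summed to [B0], [W] and the labels on the back edges. *)
Lemma sum_next : \sum_(u in X) next u = r * potential S f.
Proof.
rewrite (eq_bigr _ potential_next) !big_split /= -!mulr_suml -!mulr_sumr.
rewrite !big_split /= !sumrN sum_q -!mulr_sumr !sumr_const -[_ *+ #|X|]mulr_natr.
rewrite -[B0 *+ #|X|]mulr_natr -[W *+ #|X|]mulr_natr -/r -/W potential_now.
(* For r = 1 and r = 2 a denominator is zero, and the numerators above it vanish too. *)
have [X1|X1] := eqVneq #|X| 1%N.
  have [-> -> ->] := next_last X1; rewrite /r X1.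
  by rewrite subrr !(mul0r, mulr0, mulr1, mul1r, subrr, subr0, addr0, add0r, invr1, oppr0).
have X2 : (1 < #|X|)%N by rewrite ltn_neqAle eq_sym X1 /=; exact: card_free_gt0.
have r1 : r - 1 != 0 by rewrite subr_eq0 (eqr_nat R _ 1).
have r0 : r != 0 by rewrite (eqr_nat R _ 0); lia.
have [X2'|X2'] := eqVneq #|X| 2%N.
  rewrite (next_small_E' _) ?X2' // !mul0r; field; by rewrite r0 r1.
have r2 : r - 2 != 0 by rewrite subr_eq0 (eqr_nat R _ 2).
by field; rewrite r0 r1 r2.
Qed.

Lemma norm_p u : `|p u| <= back.
Proof. by rewrite -[back]mulr1; apply: norm_wsum => s _. Qed.

Lemma norm_q u : `|q u| <= e.
Proof. by rewrite -[e]mulr1; apply: norm_wsum => s _ //; exact: out_ge0. Qed.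

Lemma norm_B0 : `|B0| <= e * r.
Proof. by apply: norm_wsum => s _; [exact: out_ge0|exact: norm_lab]. Qed.

Lemma E'_ge0 : 0 <= E'.
Proof. by apply: sumr_ge0 => w _; exact: out_ge0. Qed.

(** Sparsity, applied to the r - 1 vertices that are still to be embedded after [v]. *)
Lemma E'_le : E' <= 2 * (r - 1).
Proof.
have -> : r - 1 = #|~: S'|%:R by rewrite /r card_free_next -addn1 natrD addrK.
rewrite -natrM; apply: le_trans (_ : (\sum_(w in ~: S') deg_in A (~: S') w)%:R <= _).
  by rewrite natr_sum; apply: ler_sum => w _; rewrite deg_inR.
by rewrite ler_nat.
Qed.

Lemma back_out : back + d = (deg_in A setT v)%:R.
Proof.
rewrite deg_inR /back /d /out [RHS](bigID (mem S)) /=; congr (_ + _).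
  by apply: eq_big => s; rewrite ?inE // A_sym.
by apply: eq_bigl => s; rewrite !inE.
Qed.

Lemma back_ge0 : 0 <= back.
Proof. by apply: sumr_ge0 => s _; rewrite ler0n. Qed.

Lemma e_swap : e = \sum_(w in ~: S') \sum_(s in S) (A w s)%:R.
Proof.
rewrite /e exchange_big /=; apply: eq_bigr => w _.
by apply: eq_bigr => s _; rewrite A_sym.
Qed.

Lemma sum_sub_deg (U : {set T}) w : \sum_(s in U) (A w s)%:R <= (deg_in A setT w)%:R :> R.
Proof.
rewrite deg_inR [leRHS](big_setID U) /= setTI ler_wpDr //.
by apply: sumr_ge0 => s _; rewrite ler0n.
Qed.

(** The edges between [S] and the complement of [S'] are counted from their ends outside of [S']. *)
Lemma e_le_deg D : (forall w, w \notin S -> (deg_in A setT w)%:R <= D) ->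
  e <= D * (r - 1).
Proof.
move=> degD; rewrite e_swap.
have -> : r - 1 = #|~: S'|%:R by rewrite /r card_free_next -addn1 natrD addrK.
rewrite mulr_natr -sumr_const; apply: ler_sum => w; rewrite !inE negb_or => /andP[_ wS].
exact: le_trans (sum_sub_deg _ _) (degD _ wS).
Qed.

Lemma e_le : e <= 2 * #|T|%:R.
Proof.
rewrite -cardsT -natrM; apply: le_trans (_ : (\sum_(w in setT) deg_in A setT w)%:R <= _).
  rewrite natr_sum [X in _ <= X](big_setID S) /= setTI ler_wpDr //.
    by apply: sumr_ge0 => s _; rewrite ler0n.
  apply: ler_sum => s _; exact: sum_sub_deg.
by rewrite ler_nat.
Qed.

Lemma norm_mul_le (a b M N : R) : `|a| <= M -> `|b| <= N -> `|a * b| <= M * N.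
Proof. by move=> aM bN; rewrite normrM ler_pM. Qed.

Lemma norm_div_le (a b M : R) : 0 < b -> `|a| <= M * b -> `|a / b| <= M.
Proof. by move=> b0 ab; rewrite normrM normfV (gtr0_norm b0) ler_pdivrMr. Qed.

(** The edges at [v] contribute 4 (back + d) <= 4 D, the correction [q] another 4 D, and the edges
    among the remaining vertices 16. *)
Lemma next_variation D u1 u2 :
  (forall w, w \notin S -> (deg_in A setT w)%:R <= D) -> u1 \in X -> u2 \in X ->
  `|next u1 - next u2| <= 8 * D + 16.
Proof.
move=> degD u1X u2X.
have degv : back + d <= D by rewrite back_out degD.
have d0 : 0 <= d by exact: out_ge0.
have b0 := back_ge0.
have [X1|X1] := eqVneq #|X| 1%N.
  have -> : u1 = u2 by apply: (card_le1_eqP (eq_leq X1)).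
  by rewrite subrr normr0; lra.
have X2 : (1 < #|X|)%N by rewrite ltn_neqAle eq_sym X1 /=; exact: card_free_gt0.
have r2 : 2 <= r by rewrite ler_nat.
have r1 : 0 < r - 1 by lra.
have Hp : `|p u1 - p u2| <= 2 * back.
  by apply: le_trans (ler_normB _ _) _; have := norm_p u1; have := norm_p u2; lra.
have Hq : `|(q u1 - q u2) / (r - 1)| <= 2 * D.
  apply: norm_div_le => //; apply: le_trans (ler_normB _ _) _.
  by have := norm_q u1; have := norm_q u2; have := e_le_deg degD; lra.
have Ha : `|(lab X u1 - lab X u2) / (r - 1)| <= 2.
  apply: norm_div_le => //; apply: le_trans (ler_normB _ _) _.
  by have := norm_lab_in u1X; have := norm_lab_in u2X; rewrite -/r; lra.
have Hd := norm_mul_le (_ : `|d| <= d) Ha; rewrite ger0_norm // in Hd.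
have {}Hd := Hd (lexx _).
(* The factor [z] is E' / (r - 2), replaced by 0 for r = 2, where [E'] is 0. *)
have [z [z0 z4 Ez]] : exists z, [/\ 0 <= z, z <= 4 &
    forall x, E' * x / ((r - 1) * (r - 2)) = z * (x / (r - 1))].
  have [X2'|X2'] := eqVneq #|X| 2%N.
    by exists 0; split=> // x; rewrite (next_small_E' _) ?X2' // !mul0r.
  have r3 : 3 <= r by rewrite ler_nat ltn_neqAle eq_sym X2'.
  have r2' : 0 < r - 2 by lra.
  exists (E' / (r - 2)); split.
  - by rewrite divr_ge0 ?E'_ge0 // ltW.
  - by rewrite ler_pdivrMr //; have := E'_le; lra.
  - by move=> x; field; rewrite ?gt_eqF // /r.
have Hz := norm_mul_le (_ : `|z| <= 4) Ha; rewrite ger0_norm // in Hz.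
have {}Hz := Hz z4.
rewrite !potential_next // !Ez.
rewrite [X in `|X|](_ : _ = 2 * (p u1 - p u2) - 2 * ((q u1 - q u2) / (r - 1))
   + 2 * (d * ((lab X u1 - lab X u2) / (r - 1)))
   - 2 * (z * ((lab X u1 - lab X u2) / (r - 1)))); last by field; rewrite gt_eqF.
move: Hp Hq Hd Hz; rewrite !ler_norml => /andP[? ?] /andP[? ?] /andP[? ?] /andP[? ?].
by apply/andP; split; lra.
Qed.

Lemma next_le_potential : exists2 u, u \in X & next u <= potential S f.
Proof.
apply/exists_inP; apply: contraT => /exists_inPn H.
have [x xX] := card_gt0P card_free_gt0.
have : \sum_(u in X) potential S f < \sum_(u in X) next u.
  apply: ltr_sum => [|u uX]; first by apply/hasP; exists x; rewrite ?mem_index_enum.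
  by rewrite ltNge H.
by rewrite sum_next sumr_const -mulr_natl ltxx.
Qed.

Lemma potential_le_next : exists2 u, u \in X & potential S f <= next u.
Proof.
apply/exists_inP; apply: contraT => /exists_inPn H.
have [x xX] := card_gt0P card_free_gt0.
have : \sum_(u in X) next u < \sum_(u in X) potential S f.
  apply: ltr_sum => [|u uX]; first by apply/hasP; exists x; rewrite ?mem_index_enum.
  by rewrite ltNge H.
by rewrite sum_next sumr_const -mulr_natl ltxx.
Qed.

(** By averaging, there are next values on both sides of the potential, and they differ by at most
    [M]. If the lower one is below -M, then the upper one is between -M and 0. *)
Lemma small_step (D M : R) :
  (forall w, w \notin S -> (deg_in A setT w)%:R <= D) -> 8 * D + 16 <= M ->
  `|potential S f| <= M -> exists2 u, u \in X & `|next u| <= M.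
Proof.
move=> degD DM; rewrite ler_norml => /andP[M1 M2].
have [u1 u1X le1] := next_le_potential; have [u2 u2X le2] := potential_le_next.
have := next_variation degD u1X u2X; rewrite ler_norml => /andP[V1 V2].
have [N1|N1] := leP (- M) (next u1).
  by exists u1 => //; rewrite ler_norml N1; lra.
by exists u2 => //; rewrite ler_norml; lra.
Qed.

(** * Embedding a large vertex *)

Section LargeStep.

Hypotheses (back_le1 : back <= 1) (many_free : #|T|%:R / 2 <= r - 2).
Hypotheses (free_gt2 : 2 < r) (W_small : `|W| <= 40^-1 * (r * (r - 1))).

(** Each term other than that of [d * lab X u] is bounded, as there is at most one back edge and
    both [e] and [E'] are O(r). The constants sum to 2 + 8 + 8 + 2 + 1/5 + 8 < 36, and d / 20 comes
    from the bound on [W]. *)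
Lemma next_drift u : u \in X ->
  `|next u - potential S f - 2 * (d * (lab X u / (r - 1)))| <= 36 + d / 20.
Proof.
move=> uX; have d0 : 0 <= d by exact: out_ge0.
have r1 : 0 < r - 1 by have := free_gt2; lra.
have r2 : 0 < r - 2 by have := free_gt2; lra.
have r0 : 0 < r by have := free_gt2; lra.
have e4 : e <= 4 * (r - 1) by have := e_le; have := many_free; lra.
have Hp := le_trans (norm_p u) back_le1.
have Hq : `|q u / (r - 1)| <= 4.
  by apply: norm_div_le => //; apply: le_trans (norm_q u) e4.
have HB : `|B0 / (r * (r - 1))| <= 4.
  apply: norm_div_le; first exact: mulr_gt0.
  by apply: le_trans norm_B0 _; rewrite mulrCA mulrC ler_pM2l.
have Hs : `|(\sum_(x in X) p x) / r| <= 1.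
  apply: norm_div_le => //; rewrite mul1r; apply: le_trans (ler_norm_sum _ _ _) _.
  rewrite /r -sumr_const; apply: ler_sum => x _; exact: le_trans (norm_p x) back_le1.
have HW : `|W / (r * (r - 1))| <= 40^-1 by apply: norm_div_le => //; exact: mulr_gt0.
have HE : `|E' / (r - 2)| <= 4.
  apply: norm_div_le => //; rewrite ger0_norm ?E'_ge0 //; have := E'_le.
  have : 3 <= r by rewrite ler_nat -(ltr_nat R).
  by lra.
have Ht : `|lab X u / (r - 1)| <= 1.
  by apply: norm_div_le => //; rewrite mul1r norm_lab_in.
have Hd := norm_mul_le (_ : `|d| <= d) HW; rewrite ger0_norm // in Hd.
have {}Hd := Hd (lexx _).
have HEW := norm_mul_le HE HW; have HEt := norm_mul_le HE Ht.
rewrite potential_next // potential_now.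
rewrite [X in `|X|](_ : _ = 2 * p u - 2 * (q u / (r - 1)) + 2 * (B0 / (r * (r - 1)))
   - 2 * ((\sum_(x in X) p x) / r) + 2 * (E' / (r - 2) * (W / (r * (r - 1))))
   - 2 * (E' / (r - 2) * (lab X u / (r - 1))) - 2 * (d * (W / (r * (r - 1)))));
  last by field; rewrite !gt_eqF.
move: Hp Hq HB Hs Hd HEW HEt; rewrite !ler_norml.
move=> /andP[? ?] /andP[? ?] /andP[? ?] /andP[? ?] /andP[? ?] /andP[? ?] /andP[? ?].
by apply/andP; split; lra.
Qed.

Lemma no_gap (H : {set T}) a b :
  H \subset X -> H != set0 -> X :\: H != set0 -> 29 / 20 <= a + b ->
  (forall u, u \in H -> a <= lab X u / (r - 1)) ->
  (forall u, u \in X :\: H -> lab X u / (r - 1) <= - b) -> False.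
Proof.
move=> HX /set0Pn[x xH] /set0Pn[y yL] ab aH bL; set L := X :\: H in y yL bL.
have r1 : 0 < r - 1 by have := free_gt2; lra.
have r0 : 0 < r by have := free_gt2; lra.
have LX : L \subset X by exact: subsetDl.
have norm_t u : u \in X -> `|lab X u / (r - 1)| <= 1.
  by move=> uX; apply: norm_div_le => //; rewrite mul1r norm_lab_in.
have a1 : a <= 1.
  apply: le_trans (aH x xH) _; have := norm_t x (subsetP HX x xH).
  by rewrite ler_norml => /andP[].
have b1 : b <= 1.
  have := norm_t y (subsetP LX y yL); rewrite ler_norml => /andP[+ _].
  by have := bL y yL; lra.
set h : R := #|H|%:R; set l : R := #|L|%:R.
have hl : h + l = r.
  rewrite /h /l /r -natrD (cardsD1 x) xH; congr _%:R.
  by rewrite -(cardsID H X) (setIidPr HX) (cardsD1 x H) xH.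
have h1 : 1 <= h by rewrite (ler_nat R 1); apply/card_gt0P; exists x.
have l1 : 1 <= l by rewrite (ler_nat R 1); apply/card_gt0P; exists y.
have split_lab u : lab X u = lab H u + lab L u.
  by rewrite /lab (big_setID H) /= (setIidPr HX).
(* By symmetry of [C], the labels between [H] and [L] enter both sums equally and cancel in
   [diff]. *)
have cross : \sum_(u in L) lab H u = \sum_(u in H) lab L u.
  by rewrite /lab exchange_big /=; apply: eq_bigr => u _; apply: eq_bigr => w _; exact: C_sym.
have inside (Y : {set T}) : `|\sum_(u in Y) lab Y u| <= #|Y|%:R * (#|Y|%:R - 1).
  apply: le_trans (ler_norm_sum _ _ _) _; rewrite mulr_natl -sumr_const.
  by apply: ler_sum => u uY; exact: norm_lab_in.
have WHL : W = \sum_(u in H) lab X u + \sum_(u in L) lab X u.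
  by rewrite /W (big_setID H) /= (setIidPr HX).
have low : a * h <= (\sum_(u in H) lab X u) / (r - 1).
  rewrite /h mulr_natr -sumr_const mulr_suml; exact: ler_sum.
have high : (\sum_(u in L) lab X u) / (r - 1) <= - b * l.
  rewrite /l mulr_natr -sumr_const mulr_suml; exact: ler_sum.
have highH : (\sum_(u in H) lab X u) / (r - 1) <= h.
  rewrite /h -sumr_const mulr_suml; apply: ler_sum => u uH.
  by have := norm_t u (subsetP HX u uH); rewrite ler_norml => /andP[].
have lowL : - l <= (\sum_(u in L) lab X u) / (r - 1).
  rewrite /l -sumr_const -sumrN mulr_suml; apply: ler_sum => u uL.
  by have := norm_t u (subsetP LX u uL); rewrite ler_norml => /andP[].
have diff : \sum_(u in H) lab X u - \sum_(u in L) lab X u <= h * (h - 1) + l * (l - 1).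
  rewrite !(eq_bigr _ (fun u _ => split_lab u)) !big_split /= cross.
  have := inside H; have := inside L; rewrite -/h -/l !ler_norml => /andP[? ?] /andP[? ?].
  lra.
(* As the two sums nearly cancel, [low] and [lowL] bound a h - l, while [high] and [highH] bound b l
   - h. *)
have Wr : `|W / (r - 1)| <= 40^-1 * r.
  by apply: norm_div_le => //; rewrite -mulrA.
move: Wr; rewrite WHL mulrDl ler_norml => /andP[Wr1 Wr2].
apply: (@gap_arith R (h / r) (l / r) a b) => //.
- by rewrite divr_gt0 //; lra.
- by rewrite divr_gt0 //; lra.
- by rewrite -mulrDl hl divff ?gt_eqF.
- have -> : a * (h / r) + b * (l / r) = (a * h + b * l) / r by field; rewrite gt_eqF.
  have -> : (h / r) ^+ 2 + (l / r) ^+ 2 = (h ^+ 2 + l ^+ 2) / r / r.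
    by field; rewrite gt_eqF.
  rewrite ler_pM2r ?invr_gt0 //.
  apply: le_trans (_ : (h * (h - 1) + l * (l - 1)) / (r - 1) <= _).
    apply: le_trans (_ : (\sum_(u in H) lab X u - \sum_(u in L) lab X u) / (r - 1) <= _).
      by rewrite mulrBl; lra.
    by rewrite ler_pM2r ?invr_gt0.
  (* This amounts to h^2 + l^2 <= (h + l)^2. *)
  rewrite ler_pdivrMr // mulrAC ler_pdivlMr // -hl; nra.
- have -> : a * (h / r) - l / r = (a * h - l) / r by field; rewrite gt_eqF.
  by rewrite ler_pdivrMr //; lra.
- have -> : b * (l / r) - h / r = (b * l - h) / r by field; rewrite gt_eqF.
  by rewrite ler_pdivrMr //; lra.
Qed.

Lemma large_step (M : R) : 36 + 3 / 2 * d <= M -> `|potential S f| <= M ->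
  exists2 u, u \in X & `|next u| <= M.
Proof.
move=> dM; rewrite ler_norml => /andP[M1 M2].
have d0 : 0 <= d by exact: out_ge0.
apply/exists_inP; apply: contraT => /exists_inPn none.
have [u1 u1X le1] := next_le_potential; have [u2 u2X le2] := potential_le_next.
pose H := [set u in X | M < next u].
have nextL u : u \in X :\: H -> next u < - M.
  rewrite in_setD => /andP[+ uX]; rewrite inE uX /= -leNgt => le_uM.
  by have := none u uX; rewrite ler_norml le_uM andbT -ltNge.
have u2H : u2 \in H.
  rewrite inE u2X /= ltNge; apply: contra (none u2 u2X) => leM.
  by rewrite ler_norml leM andbT; lra.
have u1L : u1 \in X :\: H by rewrite in_setD u1X andbT inE u1X /= -leNgt; lra.
have r1 : 0 < r - 1 by have := free_gt2; lra.
have drift1 := next_drift u1X; have drift2 := next_drift u2X.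
(* With d = 0 all next values would be within 36 <= M of the potential, so they could not lie on
   both sides of [-M, M]. *)
have dgt0 : 0 < d.
  rewrite lt_neqAle d0 andbT; apply/eqP => dE.
  move: drift1 drift2; rewrite -dE !ler_norml => /andP[? ?] /andP[? ?].
  by have := nextL _ u1L; move: u2H; rewrite inE u2X /=; lra.
(* The next values avoid [-M, M], so up to the drift error [e0] the mean labels leave a gap of
   length (M - e0) / d >= 3/2 - 1/20 = 29/20. *)
pose e0 := 36 + d / 20.
exfalso; apply: (@no_gap H ((M - potential S f - e0) / (2 * d)) ((M + potential S f - e0) / (2 * d))).
- by apply/subsetP => u; rewrite inE => /andP[].
- by apply/set0Pn; exists u2.
- by apply/set0Pn; exists u1.
- rewrite -mulrDl ler_pdivlMr ?mulr_gt0 // /e0; lra.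
- move=> u; rewrite inE => /andP[uX lt_M]; rewrite ler_pdivrMr ?mulr_gt0 //.
  by have := next_drift uX; rewrite ler_norml /e0 => /andP[? ?]; lra.
- move=> u uL; have /andP[_ uX] : (u \notin H) && (u \in X) by rewrite -in_setD.
  rewrite -mulNr ler_pdivlMr ?mulr_gt0 //.
  by have := nextL _ uL; have := next_drift uX; rewrite ler_norml /e0 => /andP[? ?]; lra.
Qed.

End LargeStep.

End Step.
Lemma potential0 f : \sum_x \sum_y C x y = 0 -> potential set0 f = 0.
Proof.
move=> C0; rewrite /potential /inner !big_set0 imset0 setC0 mulr0 !add0r.
rewrite [X in _ * X / _](_ : _ = 0) ?mulr0 ?mul0r // -[RHS]C0.
by apply: eq_big => [x|x _]; rewrite ?inE // /lab; apply: eq_bigl => y; rewrite inE.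
Qed.

Lemma potentialT f : potential setT f = \sum_x \sum_y (A x y)%:R * C (f x) (f y).
Proof.
have out0 s : out setT s = 0 by rewrite /out setCT big_set0.
rewrite /potential [X in _ + 2 / _ * X]big1 => [|s _]; last by rewrite out0 mul0r.
rewrite setCT big_set0 !mul0r mulr0 !addr0 /inner.
by apply: eq_big => [x|x _]; rewrite ?inE //; apply: eq_bigl => y; rewrite inE.
Qed.

(** * The potential as a sum without division *)

Definition sample_point (S : {set T}) (f : T -> T) (z a : T) : T :=
  if z \in S then f z else a.

(* Both ends of an edge between two vertices outside of [S] are sampled without
   replacement; at most one end matters if a single vertex is left. *)
Definition sample (S : {set T}) (f : T -> T) : R :=
  let X := ~: (f @: S) in
  \sum_(a in X) \sum_(b in X | (a != b) || (#|X| == 1%N))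
    \sum_z \sum_w (A z w)%:R * C (sample_point S f z a) (sample_point S f w b).

(** The machine cannot divide, so it compares values of [sample]; the factor relating them to the
    potential depends only on the number of free vertices. *)
Lemma sampleE (S : {set T}) (f : T -> T) : {in S &, injective f} -> (0 < #|~: (f @: S)|)%N ->
  let r := #|~: (f @: S)| in
  sample S f = (r * (if r == 1 then 1 else r.-1))%N%:R * potential S f.
Proof.
move=> f_inj; rewrite /sample /potential; set X := ~: (f @: S) => X0 /=.
(* Each point of [X] is paired with [N] points: the others, or itself if it is alone. *)
set N := if _ then _ else _; pose mask (a b : T) := (a != b) || (#|X| == 1%N).
have countN a : a \in X -> (\sum_(b in X | mask a b) 1 = N)%N.
  move=> aX; rewrite sum1_card /N; have [X1|nX1] := eqVneq #|X| 1%N.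
    by rewrite -X1; apply: eq_card => b; rewrite unfold_in /mask X1 orbT andbT.
  rewrite (cardsD1 a X) aX; apply: eq_card => b.
  by rewrite unfold_in /mask (negbTE nX1) orbF in_setD1 andbC eq_sym.
have mask_sym a b : mask a b = mask b a by rewrite /mask eq_sym.
have sum_snd (g : T -> R) :
    \sum_(a in X) \sum_(b in X | mask a b) g b = N%:R * \sum_(b in X) g b.
  rewrite (exchange_big_dep (mem X)) /=; last by move=> a b _ /andP[].
  rewrite mulr_sumr; apply: eq_bigr => b bX.
  rewrite -(countN b bX) natr_sum mulr_suml; apply: eq_big => a; last by rewrite mul1r.
  by rewrite bX mask_sym.
have sum_fst (g : T -> R) :
    \sum_(a in X) \sum_(b in X | mask a b) g a = N%:R * \sum_(a in X) g a.
  rewrite mulr_sumr; apply: eq_bigr => a aX.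
  by rewrite -(countN a aX) natr_sum mulr_suml; apply: eq_bigr => b _; rewrite mul1r.
have r0 : #|X|%:R != 0 :> R by rewrite pnatr_eq0 -lt0n.
transitivity (\sum_z \sum_w (A z w)%:R * \sum_(a in X) \sum_(b in X | mask a b)
    C (sample_point S f z a) (sample_point S f w b)).
  rewrite (eq_bigr (fun a => \sum_z \sum_w \sum_(b in X | mask a b)
     (A z w)%:R * C (sample_point S f z a) (sample_point S f w b))); last first.
    move=> a _; rewrite exchange_big /=; apply: eq_bigr => z _; exact: exchange_big.
  rewrite exchange_big /=; apply: eq_bigr => z _; rewrite exchange_big /=.
  apply: eq_bigr => w _; rewrite mulr_sumr; apply: eq_bigr => a _.
  by rewrite mulr_sumr.
(* The sum over [z] and [w] is split into four blocks, according to which of the two ends are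
   already embedded. *)
pose g z w := (A z w)%:R * \sum_(a in X) \sum_(b in X | mask a b)
    C (sample_point S f z a) (sample_point S f w b).
have SS : \sum_(z in S) \sum_(w in S) g z w = (#|X| * N)%:R * inner S f.
  rewrite mulr_sumr; apply: eq_bigr => z zS; rewrite mulr_sumr; apply: eq_bigr => w wS.
  rewrite /g /sample_point zS wS sum_snd sumr_const -mulr_natr natrM; ring.
have SC : \sum_(z in S) \sum_(w in ~: S) g z w
         = N%:R * \sum_(s in S) out S s * lab X (f s).
  rewrite mulr_sumr; apply: eq_bigr => z zS; rewrite /out mulr_suml mulr_sumr.
  apply: eq_bigr => w; rewrite inE => wS.
  by rewrite /g /sample_point zS (negbTE wS) sum_snd mulrCA.
have CS : \sum_(z in ~: S) \sum_(w in S) g z w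
         = N%:R * \sum_(s in S) out S s * lab X (f s).
  rewrite -SC exchange_big /=; apply: eq_bigr => z zS; apply: eq_bigr => w.
  rewrite inE => wS; rewrite /g /sample_point zS (negbTE wS) sum_snd sum_fst A_sym.
  by congr (_ * (_ * _)); apply: eq_bigr => a _; rewrite C_sym.
have CC : \sum_(z in ~: S) \sum_(w in ~: S) g z w
         = (\sum_(w in ~: S) out S w) * \sum_(x in X) lab X x.
  rewrite mulr_suml; apply: eq_bigr => z; rewrite inE => zS.
  rewrite /out mulr_suml; apply: eq_bigr => w; rewrite inE => wS.
  rewrite /g /sample_point (negbTE zS) (negbTE wS).
  have [zw|zw] := eqVneq z w; first by rewrite zw A_irr !mul0r.
  (* Pairs with a = b have label 0, so the restriction to [mask] does not change the sum. *)
  congr (_ * _); apply: eq_bigr => a aX; rewrite /lab big_mkcondr /=.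
  apply: eq_bigr => b bX; rewrite /mask; case: eqVneq => //= ab.
  by rewrite ab C_irr if_same.
rewrite (bigID (mem S)) /=.
rewrite (eq_bigr (fun z => \sum_(w in S) g z w + \sum_(w in ~: S) g z w)); last first.
  by move=> z _; rewrite (bigID (mem S)) /=; congr (_ + _); apply: eq_bigl => w; rewrite inE.
rewrite [X in _ + X = _](eq_big (fun z => z \in ~: S)
  (fun z => \sum_(w in S) g z w + \sum_(w in ~: S) g z w)); last first.
- by move=> z _; rewrite (bigID (mem S)) /=; congr (_ + _); apply: eq_bigl => w; rewrite inE.
- by move=> z; rewrite inE.
rewrite !big_split /= SS SC CS CC !natrM.
have [X1|X1] := eqVneq #|X| 1%N.
  rewrite (_ : \sum_(w in ~: S) out S w = 0) ?mul0r; last first.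
    rewrite big1 // => w wS; rewrite /out big1 // => w' w'S.
    have -> : w' = w.
      by apply: (card_le1_eqP (A := mem (~: S))) => //; rewrite -(card_free f_inj) X1.
    by rewrite A_irr.
  by field.
have X2 : (1 < #|X|)%N by rewrite ltn_neqAle eq_sym X1.
have -> : N%:R = #|X|%:R - 1 :> R.
  by rewrite /N (negbTE X1) -subn1 natrB.
have r1 : #|X|%:R - 1 != 0 :> R by rewrite subr_eq0 (eqr_nat R _ 1).
by field; rewrite r0 r1.
Qed.

End Potential.

(** * The greedy choice keeps the potential bounded *)

Section Greedy.

Variables (R : realFieldType) (T : finType) (A : rel T) (C : T -> T -> R).
Hypotheses (A_sym : symmetric A) (A_irr : irreflexive A).
Hypotheses (C_sym : forall x y, C x y = C y x) (C_irr : forall x, C x x = 0).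
Hypothesis C_le1 : forall x y, `|C x y| <= 1.
Hypothesis A_sparse : forall U : {set T}, (\sum_(v in U) deg_in A U v <= 2 * #|U|)%N.
Hypothesis C_total : \sum_x \sum_y C x y = 0.

Let deg := deg_in A setT.

(** Equivalently, the degree is at most an eighth of the maximum degree, which thus need not be
    computed. *)
Definition small (v : T) : bool := [exists w, (8 * deg v <= deg w)%N].

(** Large vertices have degree above 1600 / 8 = 200, whereas all degrees sum to at most 2 |T|. *)
Lemma large_rare w : (1600 < deg w)%N ->
  (100 * #|[set v | ~~ small v]| <= #|T|)%N.
Proof.
move=> degw; have := A_sparse setT; rewrite cardsT => le_deg.
have : (\sum_(v in [set v | ~~ small v]) 200 <= \sum_(v in setT) deg v)%N.
  rewrite [leqRHS](big_setID [set v | ~~ small v]) /= setTI.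
  apply: leq_trans (leq_addr _ _); apply: leq_sum => v; rewrite inE => /existsPn/(_ w).
  rewrite -ltnNge => H; lia.
by rewrite sum_nat_const; move: le_deg; rewrite -/deg; lia.
Qed.

(** Since all labels sum to 0, the sum inside [X] is minus that over the ordered pairs with an end
    outside of [X]. *)
Lemma lab_sum_free (X : {set T}) :
  `|\sum_(x in X) lab C X x| <= 2 * (#|T|%:R * #|~: X|%:R).
Proof.
have norm_row (Y Z : {set T}) : `|\sum_(x in Y) lab C Z x| <= #|Y|%:R * #|Z|%:R.
  apply: le_trans (ler_norm_sum _ _ _) _; rewrite mulr_natl -sumr_const.
  by apply: ler_sum => x _; exact: norm_lab.
have -> : \sum_(x in X) lab C X x
    = - \sum_(x in X) lab C (~: X) x - \sum_(x in ~: X) lab C setT x.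
  suff : \sum_(x in X) lab C setT x + \sum_(x in ~: X) lab C setT x = 0.
    rewrite (eq_bigr (fun x => lab C X x + lab C (~: X) x)); last first.
      by move=> x _; rewrite /lab (big_setID X) /= setTI setTD.
    rewrite big_split /=; lra.
  transitivity (\sum_(x in setT) lab C setT x).
    by rewrite [RHS](big_setID X) /= setTI setTD.
  rewrite -[RHS]C_total; apply: eq_big => [x|x _]; rewrite ?inE //.
  by apply: eq_bigl => y; rewrite inE.
have le_X : #|X|%:R * #|~: X|%:R <= #|T|%:R * #|~: X|%:R :> R.
  by rewrite ler_wpM2r // ler_nat max_card.
have := norm_row X (~: X); have := norm_row (~: X) setT; rewrite cardsT mulrC.
rewrite !ler_norml => /andP[? ?] /andP[? ?].
by apply/andP; split; lra.
Qed.

(* Small vertices are embedded after the others, each of which has at most one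
   neighbor embedded before it. If no degree exceeds 1600, which is just a large
   constant, the order does not matter. *)
Lemma greedy_step (S : {set T}) (f : T -> T) (v : T) (M : R) :
  {in S &, injective f} -> v \notin S ->
  (small v /\ forall w, w \notin S -> small w) \/
  [/\ ~~ small v, forall w, w \in S -> ~~ small w & (deg_in A S v <= 1)%N] ->
  8 * 1600 + 16 <= M -> (forall w, 3 / 2 * (deg w)%:R + 36 <= M) -> `|potential A C S f| <= M ->
  exists2 u, u \in ~: (f @: S) & `|potential A C (v |: S) (extend f v u)| <= M.
Proof.
move=> f_inj vS order leM degM pot.
have [deg_le|] := boolP [forall w, (deg w <= 1600)%N].
  apply: (small_step A_sym A_irr C_sym C_irr C_le1 A_sparse f_inj vS (D := 1600)) pot.
    by move=> w _; rewrite (ler_nat R _ 1600); exact: (forallP deg_le).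
  have := degM v; have : 0 <= (deg v)%:R :> R by rewrite ler0n.
  lra.
rewrite negb_forall => /existsP[w0]; rewrite -ltnNge => degw0.
case: order => [[small_v small_free]|[large_v largeS back1]].
  (* With D an eighth of the maximum degree, the variation 8 D + 16 is at most the maximum degree
     plus 16. *)
  have [wmax _ /= wmaxP] := @arg_maxnP T w0 xpredT deg isT.
  apply: (small_step A_sym A_irr C_sym C_irr C_le1 A_sparse f_inj vS
            (D := (deg wmax)%:R / 8)) pot.
    move=> w /small_free/existsP[w' le_w']; rewrite ler_pdivlMr // -natrM ler_nat.
    by have := wmaxP w' isT; rewrite -/deg; lia.
  have := degM wmax; have : 0 <= (deg wmax)%:R :> R by rewrite ler0n.
  lra.
(* Only large vertices have been embedded, so all but a hundredth of the vertices are free. *)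
have rare := large_rare degw0.
have S_large : (#|S| < #|[set v | ~~ small v]|)%N.
  have := subset_leq_card (_ : v |: S \subset [set v | ~~ small v]).
  rewrite cardsU1 vS add1n; apply; apply/subsetP => w; rewrite !inE.
  by case/orP => [/eqP->|/largeS].
have deg_card : (deg w0 <= #|T|)%N by rewrite /deg deg_inE; exact: max_card.
have Xcard : (#|~: (f @: S)| + #|S| = #|T|)%N.
  by rewrite -(card_in_imset f_inj) -(cardsC (f @: S)) addnC.
have r1 : (2 < #|~: (f @: S)|)%N by lia.
have nS : #|T|%:R = #|~: (f @: S)|%:R + #|S|%:R :> R by rewrite -natrD Xcard.
have rareR : 100 * #|S|%:R <= #|T|%:R :> R.
  by rewrite -natrM ler_nat; lia.
have n_big : 1600 <= #|T|%:R :> R by rewrite (ler_nat R 1600); lia.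
have S0 : 0 <= #|S|%:R :> R by rewrite ler0n.
apply: (large_step A_sym A_irr C_sym C_irr C_le1 A_sparse f_inj vS) pot.
- rewrite (_ : \sum_(s in S) _ = (deg_in A S v)%:R); first by rewrite (ler_nat R _ 1).
  by rewrite deg_inR; apply: eq_bigr => s _; rewrite A_sym.
- lra.
- by rewrite (ltr_nat R 2).
(* The bound 2 |T| |S| is at most |T|^2 / 50, to be compared with r (r - 1) / 40 for r >= 99/100
   |T|. *)
- apply: le_trans (lab_sum_free _) _; rewrite setCK (card_in_imset f_inj).
  nra.
- have := degM v; rewrite -(back_out R A_sym S v).
  by have := back_ge0 R A S v; have := out_ge0 R A S v; lra.
Qed.

End Greedy.

(** * The program *)

Definition xbool (a : xexpr) : xexpr := XIf a (XConst 1) (XConst 0).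
Definition xnot (a : xexpr) : xexpr := XIf a (XConst 0) (XConst 1).
Definition xand (a b : xexpr) : xexpr := XIf a (xbool b) (XConst 0).
Definition xor (a b : xexpr) : xexpr := XIf a (XConst 1) (xbool b).
Definition xle (a b : xexpr) : xexpr := xnot (XSub a b).
Definition xlt (a b : xexpr) : xexpr := xnot (xle b a).
Definition xeq (a b : xexpr) : xexpr := xand (xle a b) (xle b a).

Section Den.

Variables (n : nat) (m : memory).
Implicit Types (s : nat -> nat) (a b : xexpr).

Lemma nat_of_bool_neq0 (b : bool) : (nat_of_bool b != 0%N) = b.
Proof. by case: b. Qed.

Lemma den_sum s x a : den n m s (XSum x a) = (\sum_(j < n) den n m (bind s x j) a)%N.
Proof. by []. Qed.

Lemma den_if s a b c : den n m s (XIf a b c)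
  = if den n m s a != 0%N then den n m s b else den n m s c.
Proof. by []. Qed.

Lemma den_xnot s a : den n m s (xnot a) = (den n m s a == 0%N).
Proof. by rewrite /=; case: eqP. Qed.

Lemma den_xand s a b :
  den n m s (xand a b) = (den n m s a != 0%N) && (den n m s b != 0%N).
Proof. by rewrite /=; case: (den n m s a == 0%N); case: (den n m s b == 0%N). Qed.

Lemma den_xor s a b :
  den n m s (xor a b) = (den n m s a != 0%N) || (den n m s b != 0%N).
Proof. by rewrite /=; case: (den n m s a == 0%N); case: (den n m s b == 0%N). Qed.

Lemma den_xle s a b : den n m s (xle a b) = (den n m s a <= den n m s b)%N.
Proof. by rewrite /xle den_xnot. Qed.

Lemma den_xlt s a b : den n m s (xlt a b) = (den n m s a < den n m s b)%N.
Proof. by rewrite /xlt den_xnot den_xle; case: ltnP. Qed.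

Lemma den_xeq s a b : den n m s (xeq a b) = (den n m s a == den n m s b).
Proof. by rewrite /xeq den_xand !den_xle !nat_of_bool_neq0 -eqn_leq. Qed.

Lemma sum_bool_neq0 (P : pred 'I_n) :
  ((\sum_(i < n) P i)%N != 0%N) = [exists i, P i].
Proof.
rewrite sum_nat_eq0 negb_forall; apply: eq_existsb => i.
by rewrite implyTb nat_of_bool_neq0.
Qed.

End Den.

#[global] Opaque xnot xand xor xle xlt xeq.

Definition denE := (den_xnot, den_xand, den_xor, den_xle, den_xlt, den_xeq, nat_of_bool_neq0).

(** * Selecting an index with the least key *)

Section Argmin.

Variables (x y z : nat) (valid key : nat -> xexpr).

Definition xminimal (w : nat) : xexpr :=
  xand (valid w) (xnot (XSum z (xand (valid z) (xlt (key z) (key w))))).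

(** Ties are broken by taking the least minimizer, so at most one term of the sum is nonzero and the
    sum returns that index. *)
Definition xargmin : xexpr :=
  XSum x (XIf (xand (xminimal x) (xnot (XSum y (xand (xlt (XVar y) (XVar x)) (xminimal y)))))
            (XVar x) (XConst 0)).

Lemma den_xargmin n m s (V : pred nat) (K : nat -> nat) :
  uniq [:: x; y; z] ->
  (forall s' w, w \in [:: x; y; z] -> (forall w', w' \notin [:: x; y; z] -> s' w' = s w') ->
     (s' w < n)%N ->
     (den n m s' (valid w) != 0%N) = V (s' w)
     /\ (V (s' w) -> den n m s' (key w) = K (s' w))) ->
  (exists2 i, (i < n)%N & V i) ->
  exists i : 'I_n, [/\ den n m s xargmin = i, V i & forall j : 'I_n, V j -> (K i <= K j)%N].
Proof.
rewrite /= !inE !negb_or andbT => /andP[/andP[xy xz] yz] spec [i0 lt_i0 Vi0].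
pose best i := V i && [forall j : 'I_n, V j ==> (K i <= K j)%N].
have den_minimal s' w : w \in [:: x; y] ->
    (forall w', w' \notin [:: x; y; z] -> s' w' = s w') -> (s' w < n)%N ->
    (den n m s' (xminimal w) != 0%N) = best (s' w).
  move=> wxy ss lt_w; have wxyz : w \in [:: x; y; z].
    by move: wxy; rewrite !inE => /orP[->|->]; rewrite ?orbT.
  have wz : w != z by move: wxy; rewrite !inE => /orP[/eqP->|/eqP->].
  have [Vw Kw] := spec s' w wxyz ss lt_w.
  rewrite !denE /= Vw /best; have [Vsw|] //= := boolP (V (s' w)).
  rewrite -[in LHS](negbK (_ == _)) (eq_bigr (fun j : 'I_n => nat_of_bool (V j && (K j < K (s' w))%N))).
    rewrite sum_bool_neq0 negb_exists; apply: eq_forallb => j.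
    by rewrite negb_and -leqNgt implybE.
  move=> j _; set s1 := bind s' z j.
  have ss1 w' : w' \notin [:: x; y; z] -> s1 w' = s w'.
    rewrite !inE !negb_or => H; have /and3P[_ _ /negbTE w'z] := H.
    by rewrite /s1 /bind w'z ss // !inE !negb_or.
  have s1z : s1 z = j by rewrite /s1 /bind eqxx.
  have s1w : s1 w = s' w by rewrite /s1 /bind (negbTE wz).
  have [] := spec s1 z _ ss1; rewrite ?s1z // ?inE ?eqxx ?orbT // => Vz Kz.
  have [] := spec s1 w wxyz ss1; rewrite ?s1w // => _ Kw1.
  by rewrite !denE Vz; have [Vj|] //= := boolP (V j); rewrite Kz ?Kw1.
have [i1 Vi1 minK] := @arg_minnP 'I_n (Ordinal lt_i0) (fun i => V i) (fun i => K i) Vi0.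
have ex_best : exists i, (i < n)%N && best i.
  exists i1; rewrite ltn_ord /best Vi1; apply/forallP => j; apply/implyP; exact: minK.
have [k /andP[lt_k best_k] k_min] := find_ex_minn ex_best.
exists (Ordinal lt_k); split; last first.
- by move=> j Vj; have /andP[_ /forallP/(_ j)/implyP] := best_k; apply.
- by have /andP[] := best_k.
rewrite /= (bigD1 (Ordinal lt_k)) //= big1 ?addn0 => [|i].
  have sx : bind s x k x = k by rewrite /bind eqxx.
  rewrite den_xand nat_of_bool_neq0 den_minimal ?inE ?eqxx ?sx //; last first.
    by move=> w'; rewrite !inE !negb_or /bind => /andP[/negbTE-> _].
  rewrite best_k den_xnot nat_of_bool_neq0 /= big1 //= => j _.
  set s1 := bind _ y j; rewrite den_xand den_xlt nat_of_bool_neq0.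
  have s1y : s1 y = j by rewrite /s1 /bind eqxx.
  have s1x : s1 x = k by rewrite /s1 /bind (negbTE xy) eqxx.
  rewrite den_minimal ?inE ?eqxx ?orbT ?s1y //=; last first.
    by move=> w'; rewrite !inE !negb_or /s1 /bind => /and3P[/negbTE-> /negbTE-> _].
  rewrite s1x s1y; apply/eqP; rewrite eqb0; apply/negP => /andP[lt_jk best_j].
  by have := k_min j; rewrite ltn_ord best_j => /(_ isT); rewrite leqNgt lt_jk.
rewrite -val_eqE /= => ne_ik; case: ifP => //.
have sx : bind s x i x = i by rewrite /bind eqxx.
rewrite den_xand nat_of_bool_neq0 den_minimal ?inE ?eqxx ?sx //; last first.
  by move=> w'; rewrite !inE !negb_or /bind => /andP[/negbTE-> _].
case/andP=> best_i; rewrite den_xnot nat_of_bool_neq0 /= sum_nat_eq0 => /forallP/(_ (Ordinal lt_k)).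
rewrite implyTb; set s1 := bind _ y _; rewrite den_xand den_xlt nat_of_bool_neq0.
have s1y : s1 y = k by rewrite /s1 /bind eqxx.
have s1x : s1 x = i by rewrite /s1 /bind (negbTE xy) eqxx.
rewrite den_minimal ?inE ?eqxx ?orbT ?s1y //=; last first.
  by move=> w'; rewrite !inE !negb_or /s1 /bind => /and3P[/negbTE-> /negbTE-> _].
rewrite s1x s1y best_k andbT eqb0 -leqNgt => le_ik.
by have := k_min i; rewrite ltn_ord best_i => /(_ isT) le_ki; rewrite eqn_leq le_ik le_ki in ne_ik.
Qed.

End Argmin.

(** * The program that ranks the vertices *)

Definition ranks := 6%N.
Definition images := 7%N.
Definition current := 8%N.

(* Variable 0 is reserved for the multiplication by [n] in the index. *)
Definition xentry (a : nat) (u v : xexpr) : xexpr := XRead a (XAdd (XSum 0 u) v).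

Definition xadj : xexpr -> xexpr -> xexpr := xentry 2.

Definition xdouble (a : xexpr) : xexpr := XAdd a a.

Definition xdeg (v : nat) : xexpr := XSum 1 (xadj (XVar v) (XVar 1)).

Definition xsmall (v : nat) : xexpr :=
  XSum 2 (xle (xdouble (xdouble (xdouble (xdeg v)))) (xdeg 2)).

Definition xunranked (v : nat) : xexpr := xnot (XRead ranks (XVar v)).

(** Small vertices are ranked first, then leaves of the forest on the unranked vertices are removed
    one by one; embedding goes through the ranks backwards. *)
Definition xrank_key (v : nat) : xexpr :=
  XIf (xsmall v) (XConst 0)
    (XAdd (XConst 1) (XSum 3 (xand (xunranked 3) (xadj (XVar v) (XVar 3))))).

Definition rank_loop : stmt :=
  SFor 10 (SAssign ranks (xargmin 11 12 13 xunranked xrank_key)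
             (XAdd (XVar 10) (XConst 1))).

(** * Ranking the vertices *)

Section Ranking.

Variables (T : finType) (A : rel T).
Hypotheses (A_sym : symmetric A) (A_irr : irreflexive A).
Hypothesis A_acyclic : forall p : seq T, ucycle A p -> (size p <= 2)%N.

Implicit Types (rk : T -> nat) (v w : T).

(* Vertices are ranked from 1 on, rank 0 means that a vertex is not ranked yet. *)
Definition above rk v : {set T} := [set w | (rk w == 0%N) || (rk v < rk w)%N].

(** The case distinction of [greedy_step] at the time when [v] is embedded, the vertices
    [above rk v] being those embedded before it. *)
Definition well_ranked rk v : Prop :=
  (small A v /\ forall w, (0 < rk w <= rk v)%N -> small A w) \/
  [/\ ~~ small A v, forall w, w \in above rk v -> ~~ small A w
    & (deg_in A (above rk v) v <= 1)%N].

Record ranking (t : nat) rk : Prop := Ranking {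
  rank_le : forall v, (rk v <= t)%N;
  rank_inj : forall v w, rk v = rk w -> rk v != 0%N -> v = w;
  rank_card : #|[set v | rk v == 0%N]| = (#|T| - t)%N;
  rank_well : forall v, rk v != 0%N -> well_ranked rk v }.

Definition rank_key rk v : nat :=
  if small A v then 0%N else (1 + deg_in A [set w | rk w == 0%N] v)%N.

Lemma deg_in_sub (U U' : {set T}) v : U \subset U' -> (deg_in A U v <= deg_in A U' v)%N.
Proof.
by move=> sub; rewrite /deg_in [leqRHS](big_setID U) /= (setIidPr sub) leq_addr.
Qed.

(** Small vertices have the least key 0. So if [v] is large, then all unranked vertices are, and [v]
    has at most one unranked neighbor because some unranked vertex is a leaf among them. *)
Lemma ranking_step t rk rk' v : ranking t rk -> rk v = 0%N ->
  (forall w, rk w = 0%N -> (rank_key rk v <= rank_key rk w)%N) ->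
  (forall w, rk' w = if w == v then t.+1 else rk w) -> ranking t.+1 rk'.
Proof.
move=> [le_t inj card well] rv0 vmin rk'E.
have rk'v : rk' v = t.+1 by rewrite rk'E eqxx.
have rk'N w : w != v -> rk' w = rk w by rewrite rk'E => /negbTE->.
split.
- move=> w; rewrite rk'E; case: eqP => // _; have := le_t w; lia.
- move=> w1 w2; rewrite !rk'E; case: eqP => [->|_]; case: eqP => [->|_] //.
  + by have := le_t w2; lia.
  + by have := le_t w1; lia.
  + exact: inj.
- have := cardsD1 v [set v | rk v == 0%N]; rewrite inE rv0 eqxx card.
  have -> : [set v | rk v == 0%N] :\ v = [set v | rk' v == 0%N].
    by apply/setP => w; rewrite !inE rk'E; case: eqP.
  lia.
move=> w; have [-> _|wv rw0] := eqVneq w v; last first.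
  rewrite rk'N // in rw0.
  (* The vertex [v] was above [w] as an unranked one, and stays above it with the largest rank. *)
  have aboveE : above rk' w = above rk w.
    apply/setP => x; rewrite !inE (rk'N w) //.
    by have [->|xv] := eqVneq x v; rewrite ?rk'v ?rk'N // rv0 /=; have := le_t w; lia.
  rewrite /well_ranked aboveE; case: (well w rw0) => [[sw below]|[]]; [left|by right].
  split=> // x; rewrite (rk'N w) //.
  have [->|xv] := eqVneq x v; first by rewrite rk'v; have := le_t w; lia.
  by rewrite rk'N //; exact: below.
have [sv|lv] := boolP (small A v).
  (* If a large [x] had been ranked before, then [v], being above it, would be large. *)
  left; split=> // x; have [-> //|xv] := eqVneq x v; rewrite rk'N // => /andP[rx _].
  case: (well x) => [|[]//|[_ big _]]; first by rewrite -lt0n.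
  by have := big v; rewrite inE rv0 /= sv => /(_ isT).
have all_large w' : rk w' = 0%N -> ~~ small A w'.
  by move=> /vmin; rewrite /rank_key (negbTE lv); case: ifP.
have above_sub : above rk' v \subset [set w | rk w == 0%N].
  apply/subsetP => x; rewrite !inE rk'v.
  have [-> _|xv] := eqVneq x v; first by rewrite rv0.
  by rewrite rk'N //; case: eqP => //= _; have := le_t x; lia.
right; split=> //.
  by move=> x /(subsetP above_sub); rewrite inE => /eqP; exact: all_large.
apply: leq_trans (deg_in_sub _ above_sub) _.
have [|x] := @forest_leaf _ A A_sym A_irr A_acyclic [set w | rk w == 0%N].
  by apply/set0Pn; exists v; rewrite inE rv0.
rewrite inE => /eqP rx0 degx; have := vmin x rx0.
by rewrite /rank_key (negbTE lv) (negbTE (all_large x rx0)); lia.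
Qed.

End Ranking.

(** * Semantics of the program *)

Lemma index_inj n (i j i' j' : 'I_n) :
  (i * n + j = i' * n + j')%N -> i = i' /\ j = j'.
Proof.
move=> E; have n0 : (0 < n)%N by apply: leq_ltn_trans (ltn_ord i).
have iE : i = i'.
  by apply: val_inj; have := congr1 (divn^~ n) E; rewrite !divnMDl // !divn_small ?addn0.
split=> //; apply: val_inj.
by move: E; rewrite iE => /eqP; rewrite eqn_add2l => /eqP.
Qed.

Lemma row_majorE n (r : rel 'I_n) (i j : 'I_n) : row_major r (i * n + j) = r i j.
Proof.
rewrite /row_major; congr nat_of_bool; apply/existsP/idP => [[i' /existsP[j']]|rij].
  by case/andP=> /eqP /index_inj[-> ->].
by exists i; apply/existsP; exists j; rewrite eqxx.
Qed.

Lemma iteri_ind (X : Type) (I : nat -> X -> Prop) n (g : nat -> X -> X) x :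
  I 0%N x -> (forall j y, (j < n)%N -> I j y -> I j.+1 (g j y)) -> I n (iteri n g x).
Proof.
move=> I0 step; suff H k : (k <= n)%N -> I k (iteri k g x) by exact: H.
elim: k => //= k IHk lt_kn; apply: step => //; apply: IHk; exact: ltnW.
Qed.

Lemma sden_for n x p s M :
  sden n (SFor x p) s M = iteri n (fun j => sden n p (bind s x j)) M.
Proof. by []. Qed.

Lemma sden_assign n a e1 e2 s M :
  sden n (SAssign a e1 e2) s M = update M a (den n M s e1) (den n M s e2).
Proof. by []. Qed.

Lemma sden_seq n p1 p2 s M : sden n (SSeq p1 p2) s M = sden n p2 s (sden n p1 s M).
Proof. by []. Qed.

Section Semantics.

Variables (n : nat) (L A : rel 'I_n).

Record inputs (M : memory) : Prop := Inputs {
  input_size : M 0%N 0%N = n;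
  input_labels : forall i j : 'I_n, M 1%N (i * n + j)%N = L i j;
  input_adj : forall i j : 'I_n, M 2%N (i * n + j)%N = A i j }.

Lemma inputs_update M a i x : (2 < a)%N -> inputs M -> inputs (update M a i x).
Proof.
by move=> a2 [E0 E1 E2]; split=> *; rewrite /update; case: eqP => [E|_ //=]; lia.
Qed.

Variable M : memory.
Hypothesis M_inputs : inputs M.

Lemma den_xentry s a u v (i j : 'I_n) :
  (forall k, den n M (bind s 0 k) u = i) -> den n M s v = j ->
  den n M s (xentry a u v) = M a (i * n + j)%N.
Proof.
move=> Hu Hv; rewrite /xentry /= Hv (eq_bigr (fun _ => nat_of_ord i)) => [|k _]; last exact: Hu.
by rewrite sum_nat_const card_ord mulnC.
Qed.

Lemma den_xadj s u v (i j : 'I_n) :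
  (forall k, den n M (bind s 0 k) u = i) -> den n M s v = j ->
  den n M s (xadj u v) = A i j.
Proof. by move=> Hu Hv; rewrite /xadj (den_xentry _ Hu Hv) input_adj. Qed.

Lemma den_xdeg (s : nat -> nat) (v : nat) (i : 'I_n) : v \notin [:: 0; 1]%N -> s v = i ->
  den n M s (xdeg v) = deg_in A setT i.
Proof.
rewrite !inE negb_or => /andP[/negbTE v0 /negbTE v1] sv.
rewrite /= /deg_in; apply: eq_big => [j|j _]; first by rewrite inE.
rewrite -[RHS](@den_xadj (bind s 1 j) (XVar v) (XVar 1)) //.
by move=> k; rewrite /= /bind v0 v1 sv.
Qed.

Lemma den_xsmall (s : nat -> nat) (v : nat) (i : 'I_n) : v \notin [:: 0; 1; 2]%N -> s v = i ->
  (den n M s (xsmall v) != 0%N) = small A i.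
Proof.
rewrite !inE !negb_or => /and3P[v0 v1 /negbTE v2] sv.
rewrite /xsmall [den _ _ _ _]/= -[RHS]sum_bool_neq0; congr (_ != _); apply: eq_bigr => j _.
rewrite den_xle; set s1 := bind s 2 j.
have -> : den n M s1 (xdeg 2) = deg_in A setT j by exact: den_xdeg.
have E : den n M s1 (xdeg v) = deg_in A setT i.
  by apply: den_xdeg; rewrite ?inE ?negb_or ?v0 // /s1 /bind v2.
have double a : den n M s1 (xdouble a) = (2 * den n M s1 a)%N by rewrite mul2n -addnn.
by rewrite !double E !mulnA.
Qed.

Lemma den_xrank_key (s : nat -> nat) (v : nat) (i : 'I_n) (rk : 'I_n -> nat) :
  (forall i : 'I_n, M ranks i = rk i) -> v \notin [:: 0; 1; 2; 3]%N -> s v = i ->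
  den n M s (xrank_key v) = rank_key A rk i.
Proof.
move=> Mrk; rewrite !inE !negb_or => /and4P[v0 v1 v2 v3] sv.
rewrite /xrank_key /rank_key [LHS]/= (@den_xsmall s v i) ?inE ?negb_or ?v0 ?v1 //.
case: ifP => // _; congr addn; rewrite /deg_in [RHS]big_mkcond /=; apply: eq_bigr => j _.
rewrite den_xand /xunranked den_xnot nat_of_bool_neq0 (@den_xadj _ _ _ i j) //.
  by rewrite [den _ _ _ _]/= Mrk inE nat_of_bool_neq0; case: eqP.
by move=> k; rewrite /= /bind (negbTE v0) (negbTE v3) sv.
Qed.

End Semantics.

Section RankLoop.

Variables (n : nat) (L A : rel 'I_n).
Hypotheses (A_sym : symmetric A) (A_irr : irreflexive A).
Hypothesis A_acyclic : forall p : seq 'I_n, ucycle A p -> (size p <= 2)%N.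

Lemma rank_loop_correct M s : inputs L A M -> (forall i, M ranks i = 0%N) ->
  (forall i, M images i = 0%N) ->
  let M' := sden n rank_loop s M in
  [/\ inputs L A M', ranking A n (fun i : 'I_n => M' ranks i)
    & forall i, M' images i = 0%N].
Proof.
move=> inM rk0 im0; rewrite /rank_loop sden_for.
apply: (iteri_ind (I := fun t M' => [/\ inputs L A M',
   ranking A t (fun i : 'I_n => M' ranks i) & forall i, M' images i = 0%N])).
  split=> //; split=> [v|v w||v]; rewrite ?rk0 //.
  rewrite subn0 -cardsT; apply: eq_card => v; by rewrite !inE rk0.
move=> t M' lt_tn [inM' rkM' imM'].
(* The key must be a function on all naturals; 0 is a dummy value from [n] on. *)
have [||i []] := @den_xargmin 11 12 13 xunranked xrank_key n M' (bind s 10 t)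
  (fun i => M' ranks i == 0%N)
  (fun i => if insub i is Some i' then rank_key A (fun i : 'I_n => M' ranks i) i' else 0%N) isT.
- move=> s' w w_in _ lt_w; split; first by rewrite /xunranked den_xnot nat_of_bool_neq0.
  rewrite insubT => _; apply: (den_xrank_key inM') => //.
  by move: w_in; rewrite !inE => /or3P[]/eqP->.
- have : (0 < #|[set i : 'I_n | M' ranks i == 0%N]|)%N.
    by rewrite (rank_card rkM') card_ord subn_gt0.
  by case/card_gt0P=> i; rewrite inE => Mi; exists i.
have tE : den n M' (bind s 10 t) (XAdd (XVar 10) (XConst 1)) = t.+1.
  by rewrite /= /bind /= addn1.
rewrite sden_assign tE => -> /eqP Mi imin; set M2 := update _ _ _ _.
split.
- exact: inputs_update.
- apply: (ranking_step A_sym A_irr A_acyclic rkM' Mi).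
    move=> w /eqP Mw; have := imin w Mw.
    by rewrite !valK.
  by move=> w; rewrite /M2 /update /=.
- by move=> j; rewrite /M2 /update /=.
Qed.

End RankLoop.

(* The image of a vertex is stored shifted by 1; a vertex without an image has 0. *)
Definition ximg (z : nat) : xexpr := XRead images (XVar z).

Definition xcur : xexpr := XRead current (XConst 0).

Definition xvacant (x : nat) : xexpr :=
  xnot (XSum 4 (xeq (ximg 4) (XAdd (XVar x) (XConst 1)))).

(* The expressions below evaluate the embedding extended by mapping the current
   vertex to the value of variable [u]. *)
Definition xfree (u a : nat) : xexpr := xand (xvacant a) (xnot (xeq (XVar a) (XVar u))).

Definition xpoint (u z a : nat) : xexpr :=
  XIf (xeq (XVar z) xcur) (XVar u)
    (XIf (ximg z) (XSub (ximg z) (XConst 1)) (XVar a)).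

Definition xpositive (a b : xexpr) : xexpr := xentry 1 a b.

Definition xnegative (a b : xexpr) : xexpr := xand (xnot (xeq a b)) (xnot (xpositive a b)).

(* The current vertex has rank 2 iff a single vertex is left after it. *)
Definition xpair (u : nat) : xexpr :=
  xand (xfree u 5) (xand (xfree u 6)
    (xor (xnot (xeq (XVar 5) (XVar 6))) (xeq (XRead ranks xcur) (XConst 2)))).

(** Positive and negative labels in [sample] are counted separately, as the machine has no negative
    numbers. *)
Definition xcount (g : xexpr -> xexpr -> xexpr) (u : nat) : xexpr :=
  XSum 5 (XSum 6 (XIf (xpair u)
    (XSum 7 (XSum 8 (XIf (xadj (XVar 7) (XVar 8))
       (g (xpoint u 7 5) (xpoint u 8 6)) (XConst 0))))
    (XConst 0))).

(** One of the two truncated differences is 0, so their sum is an absolute value. *)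
Definition xembed_key (u : nat) : xexpr :=
  XAdd (XSub (xcount xpositive u) (xcount xnegative u))
       (XSub (xcount xnegative u) (xcount xpositive u)).

(** Round i embeds the vertex of rank n - i, found as the only term of a sum. *)
Definition embed_next : stmt :=
  SSeq
    (SAssign current (XConst 0)
      (XSum 11 (XIf (xeq (XAdd (XRead ranks (XVar 11)) (XVar 10)) (XRead 0 (XConst 0)))
                  (XVar 11) (XConst 0))))
    (SAssign images xcur (XAdd (xargmin 11 12 13 xvacant xembed_key) (XConst 1))).

Definition embed_loop : stmt := SFor 10 embed_next.

Definition label_of (R : realFieldType) (T : eqType) (L : rel T) (x y : T) : R :=
  if x == y then 0 else if L x y then 1 else -1.

(** * The embedding key equals the absolute value of the sample sum *)

Section EmbedKey.

Variables (R : realFieldType) (n : nat) (L A : rel 'I_n) (M : memory).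
Variables (S : {set 'I_n}) (f : 'I_n -> 'I_n) (v : 'I_n).
Hypotheses (M_inputs : inputs L A M) (vS : v \notin S).
Hypothesis M_images : forall z : 'I_n, M images z = if z \in S then (f z).+1 else 0%N.
Hypothesis L_irr : irreflexive L.
Hypothesis M_current : M current 0%N = v.
Hypothesis M_rank : M ranks v = #|~: (f @: S)|.

Implicit Types (s : nat -> nat) (i j k : 'I_n).

Lemma den_xvacant s (x : nat) i : x != 4 -> s x = i ->
  (den n M s (xvacant x) != 0%N) = (i \notin f @: S).
Proof.
move=> /negbTE x4 sx; rewrite /xvacant den_xnot nat_of_bool_neq0.
rewrite -[_ == _]negbK; congr (~~ _).
rewrite [den _ _ _ _]/= (eq_bigr (fun z => nat_of_bool ((z \in S) && (i == f z)))).
  rewrite sum_bool_neq0; apply/existsP/imsetP => [[z /andP[zS /eqP E]]|[z zS ->]].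
    by exists z.
  by exists z; rewrite zS eqxx.
move=> z _; rewrite den_xeq /= M_images /bind x4 sx addn1 /=.
by case: (z \in S) => //=; rewrite eqSS eq_sym.
Qed.

Lemma den_xfree s (u a : nat) i j : a != 4 -> s u = i -> s a = j -> i \notin f @: S ->
  (den n M s (xfree u a) != 0%N) = (j \in ~: (extend f v i @: (v |: S))).
Proof.
move=> a4 su sa iX; rewrite free_extend // ?inE // /xfree den_xand nat_of_bool_neq0.
rewrite (@den_xvacant _ _ j) // den_xnot den_xeq !nat_of_bool_neq0 /= sa su.
by rewrite andbC val_eqE; case: (j == i).
Qed.

Lemma den_xpoint s (u z a : nat) i j k : s u = i -> s z = j -> s a = k ->
  den n M s (xpoint u z a) = sample_point (v |: S) (extend f v i) j k.
Proof.
move=> su sz sa; rewrite /xpoint /sample_point /extend !inE [LHS]/= den_xeq.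
rewrite nat_of_bool_neq0 /= M_current su sz sa val_eqE.
case: (j == v) => //=; rewrite M_images; case: (j \in S) => //=.
by rewrite subn1.
Qed.

Lemma den_xpair s (u : nat) i j k : s u = i -> s 5%N = j -> s 6%N = k -> i \notin f @: S ->
  let X := ~: (extend f v i @: (v |: S)) in
  (den n M s (xpair u) != 0%N)
  = [&& j \in X, k \in X & (j != k) || (#|X| == 1%N)].
Proof.
move=> su s5 s6 iX X; rewrite /xpair den_xand nat_of_bool_neq0 (@den_xfree _ _ _ i j) //.
rewrite den_xand nat_of_bool_neq0 (@den_xfree _ _ _ i k) // -/X.
rewrite den_xor den_xnot !den_xeq !nat_of_bool_neq0 /= s5 s6 M_current M_rank val_eqE.
have -> : (#|X| == 1%N) = (#|~: (f @: S)| == 2%N).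
  by rewrite /X free_extend ?inE // (cardsD1 i (~: _)) !inE iX.
by case: (j == k).
Qed.

Lemma den_xcount (g : xexpr -> xexpr -> xexpr) (G : rel 'I_n) s (u : nat) i :
  (forall s a b j k, (forall t, den n M (bind s 0 t) a = j) ->
     den n M s a = j -> den n M s b = k -> den n M s (g a b) = G j k) ->
  u \notin [:: 0; 4; 5; 6; 7; 8]%N -> s u = i -> i \notin f @: S ->
  let X := ~: (extend f v i @: (v |: S)) in
  den n M s (xcount g u) =
  (\sum_(a in X) \sum_(b in X | (a != b) || (#|X| == 1)) \sum_z \sum_w
     A z w * G (sample_point (v |: S) (extend f v i) z a)
               (sample_point (v |: S) (extend f v i) w b))%N.
Proof.
move=> den_g; rewrite !inE !negb_or => /and5P[/negbTE u0 u4 /negbTE u5 /negbTE u6].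
case/andP=> /negbTE u7 /negbTE u8 su iX X.
rewrite /xcount den_sum [RHS]big_mkcond; apply: eq_bigr => a _.
transitivity (\sum_(b < n) if [&& a \in X, b \in X & (a != b) || (#|X| == 1%N)] then
   (\sum_z \sum_w A z w * G (sample_point (v |: S) (extend f v i) z a)
               (sample_point (v |: S) (extend f v i) w b)) else 0)%N; last first.
  case: (a \in X) => /=; last by rewrite big1.
  by rewrite [RHS]big_mkcond.
rewrite den_sum; apply: eq_bigr => b _; set s1 := bind (bind s 5 a) 6 b.
have s1u : s1 u = i by rewrite /s1 /bind u5 u6.
rewrite den_if (@den_xpair s1 u i a b) // -/X; case: ifP => // _.
rewrite den_sum; apply: eq_bigr => z _; rewrite den_sum; apply: eq_bigr => w _; set s2 := bind (bind s1 7 z) 8 w.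
rewrite den_if (den_xadj M_inputs (i := z) (j := w)) // nat_of_bool_neq0.
case: (A z w); rewrite ?mul1n ?mul0n //.
have s2u : s2 u = i by rewrite /s2 /bind u7 u8.
apply: den_g => [t||]; apply: den_xpoint => //.
by rewrite /bind u0.
Qed.

Lemma den_xembed_key s (u : nat) i :
  u \notin [:: 0; 4; 5; 6; 7; 8]%N -> s u = i -> i \notin f @: S ->
  (den n M s (xembed_key u))%:R
  = `|sample A (label_of R L) (v |: S) (extend f v i)|.
Proof.
move=> u_notin su iX; pose G_ (j k : 'I_n) := (j != k) && ~~ L j k.
pose Gp (j k : 'I_n) := L j k.
have den_pos s' a b j k : (forall t, den n M (bind s' 0 t) a = j) ->
    den n M s' a = j -> den n M s' b = k -> den n M s' (xpositive a b) = L j k.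
  by move=> Ha _ Hb; rewrite /xpositive (den_xentry _ Ha Hb) (input_labels M_inputs).
have den_neg s' a b j k : (forall t, den n M (bind s' 0 t) a = j) ->
    den n M s' a = j -> den n M s' b = k -> den n M s' (xnegative a b) = G_ j k.
  move=> Ha sa sb; rewrite /xnegative den_xand !den_xnot den_xeq (den_pos _ _ _ _ _ Ha sa sb).
  by rewrite sa sb !nat_of_bool_neq0 val_eqE /G_; case: (j == k); case: (L j k).
have Ep := den_xcount den_pos u_notin su iX; have En := den_xcount den_neg u_notin su iX.
have -> : den n M s (xembed_key u) = `|(den n M s (xcount xpositive u))%:Z
    - (den n M s (xcount xnegative u))%:Z|%N.
  rewrite -[LHS]/((den n M s (xcount xpositive u) - den n M s (xcount xnegative u)) +
    (den n M s (xcount xnegative u) - den n M s (xcount xpositive u)))%N; lia.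
rewrite natr_absz intr_norm intrB -!pmulrn Ep En /sample !natr_sum -sumrB.
congr `|_|; apply: eq_bigr => a _; rewrite !natr_sum -sumrB.
apply: eq_bigr => b _; rewrite !natr_sum -sumrB.
apply: eq_bigr => z _; rewrite !natr_sum -sumrB.
apply: eq_bigr => w _; rewrite !natrM -mulrBr; congr (_ * _).
rewrite /label_of /G_; case: eqVneq => [->|_] /=; last by case: (L _ _); rewrite ?subr0 ?sub0r.
by rewrite L_irr subrr.
Qed.

End EmbedKey.

(** * Correctness of the embedding loop *)

Section EmbedLoop.

Variables (R : realFieldType) (n : nat) (L A : rel 'I_n).
Hypotheses (A_sym : symmetric A) (A_irr : irreflexive A).
Hypothesis A_acyclic : forall p : seq 'I_n, ucycle A p -> (size p <= 2)%N.
Hypotheses (L_sym : symmetric L) (L_irr : irreflexive L).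

Let C := label_of R L.

Hypothesis C_total : \sum_x \sum_y C x y = 0.

Variable B : R.
Hypothesis B_small : 8 * 1600 + 16 <= B.
Hypothesis B_deg : forall w, 3 / 2 * (deg_in A setT w)%:R + 36 <= B.

Lemma label_of_sym x y : C x y = C y x.
Proof. by rewrite /C /label_of eq_sym L_sym. Qed.

Lemma label_of_irr x : C x x = 0.
Proof. by rewrite /C /label_of eqxx. Qed.

Lemma label_of_le1 x y : `|C x y| <= 1.
Proof.
by rewrite /C /label_of; case: eqP => _; [|case: (L x y)]; rewrite ?normrN ?normr0 ?normr1.
Qed.

Lemma rank_surj rk t : ranking A n rk -> (0 < t <= n)%N -> exists v : 'I_n, rk v = t.
Proof.
move=> [le_n inj card _] /andP[t0 tn].
have rk_gt0 v : (0 < rk v)%N.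
  rewrite lt0n; apply/negP => rv0.
  have : v \in [set v | rk v == 0%N] by rewrite inE.
  by move: card; rewrite card_ord subnn => /cards0_eq->; rewrite inE.
have lt_n v : ((rk v).-1 < n)%N by have := le_n v; have := rk_gt0 v; lia.
pose g v := Ordinal (lt_n v).
have g_inj : injective g.
  move=> v w /(congr1 val) /= E; apply: inj; last by rewrite -lt0n.
  by have := rk_gt0 v; have := rk_gt0 w; lia.
have t1 : (t.-1 < n)%N by lia.
have [h _ gh] := injF_bij g_inj.
exists (h (Ordinal t1)); have := congr1 val (gh (Ordinal t1)) => /=.
by have := rk_gt0 (h (Ordinal t1)); lia.
Qed.

Record embedding (rk : 'I_n -> nat) (i : nat) (M : memory) : Prop := Embedding {
  embed_inputs : inputs L A M;
  embed_ranks : forall v : 'I_n, M ranks v = rk v;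
  embed_map : exists (S : {set 'I_n}) (f : 'I_n -> 'I_n), [/\ S = [set v | (n - i < rk v)%N], #|S| = i,
    {in S &, injective f},
    forall z : 'I_n, M images z = if z \in S then (f z).+1 else 0%N
    & `|potential A C S f| <= B] }.

Lemma embed_step rk i M s : ranking A n rk -> (i < n)%N -> embedding rk i M ->
  embedding rk i.+1 (sden n embed_next (bind s 10 i) M).
Proof.
move=> rkR lt_in [inM Mrk [S [f [SE cardS f_inj Mim pot]]]].
have [v rkv] : exists v, rk v = (n - i)%N by apply: rank_surj rkR _; lia.
have rk_eq w : (rk w == n - i)%N = (w == v).
  apply/eqP/eqP => [E|-> //]; apply: rank_inj rkR _ _ _ _; first by rewrite E rkv.
  by rewrite E; lia.
rewrite /embed_next sden_seq [sden n _ _ M]sden_assign.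
set cur := den n M _ (XSum 11 _).
have {cur}-> : cur = v.
  rewrite /cur den_sum (bigD1 v) //= big1 ?addn0.
    by rewrite den_xeq nat_of_bool_neq0 /= Mrk (input_size inM) rkv subnK ?eqxx // ltnW.
  move=> w wv; rewrite den_xeq nat_of_bool_neq0 /= Mrk (input_size inM) /bind /=.
  case: eqP => // E; move: wv; rewrite -rk_eq; lia.
set M1 := update M current _ _.
have inM1 : inputs L A M1 by exact: inputs_update.
have vS : v \notin S by rewrite SE inE rkv ltnn.
have M1rk w : M1 ranks w = M ranks w by [].
have M1im : forall z : 'I_n, M1 images z = if z \in S then (f z).+1 else 0%N by exact: Mim.
have M1cur : M1 current 0%N = v by rewrite /M1 /update !eqxx.
have Xcard : #|~: (f @: S)| = (n - i)%N.
  by have := cardsC (f @: S); rewrite card_ord (card_in_imset f_inj) cardS => E; lia.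
have M1v : M1 ranks v = #|~: (f @: S)| by rewrite M1rk Mrk rkv Xcard.
rewrite sden_assign.
have curE s' : den n M1 s' xcur = v by exact: M1cur.
rewrite curE; set xarg := xargmin _ _ _ _ _.
(* By [den_xembed_key] the key depends only on the value of its variable, so the valuation may be
   taken constant. *)
have [||u []] := @den_xargmin 11 12 13 xvacant xembed_key n M1 (bind s 10 i)
  (fun x => if insub x is Some x' then (x' : 'I_n) \notin f @: S else false)
  (fun x => den n M1 (fun _ => x) (xembed_key 11)) isT.
- move=> s' w w_in _ lt_w; rewrite insubT.
  have wE : s' w = Ordinal lt_w by [].
  have w_notin : w \notin [:: 0; 4; 5; 6; 7; 8]%N.
    by move: w_in; rewrite !inE => /or3P[]/eqP->.
  split.
    apply: den_xvacant wE => //; by move: w_notin; rewrite !inE => /norP[_ /norP[]].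
  move=> wX; apply/eqP; rewrite -(eqr_nat R).
  rewrite (den_xembed_key R inM1 vS M1im L_irr M1cur M1v w_notin wE wX).
  by rewrite (den_xembed_key (i := Ordinal lt_w) R inM1 vS M1im L_irr M1cur M1v).
- have : (0 < #|~: (f @: S)|)%N by rewrite Xcard subn_gt0.
  by case/card_gt0P=> x; rewrite inE => xX; exists x; rewrite ?valK.
rewrite -/xarg => argE; rewrite valK => uX u_min.
set e := XAdd _ _.
have -> : den n M1 (bind s 10 i) e = u.+1 by rewrite -argE -[RHS]addn1.
set M2 := update _ _ _ _.
have SE' : v |: S = [set w | (n - i.+1 < rk w)%N].
  apply/setP => w; rewrite !inE -rk_eq SE inE; lia.
split.
- exact: inputs_update.
- by move=> w; exact: Mrk.
exists (v |: S), (extend f v u); split=> //.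
- by rewrite cardsU1 vS cardS.
- by apply: extend_inj => //; rewrite inE.
- move=> z; rewrite /M2 /update /= !inE /extend val_eqE.
  by case: (z == v) => //=; exact: M1im.
have order : (small A v /\ forall w, w \notin S -> small A w) \/
  [/\ ~~ small A v, forall w, w \in S -> ~~ small A w & (deg_in A S v <= 1)%N].
  have rk0 w : (0 < rk w)%N.
    rewrite lt0n; apply/negP => rw0.
    have : w \in [set w | rk w == 0%N] by rewrite inE.
    by have := rank_card rkR; rewrite card_ord subnn => /cards0_eq->; rewrite inE.
  have aboveE : above rk v = S.
    by apply/setP => w; rewrite SE !inE rkv; have := rk0 w; case: (rk w).
  have [|[sv below]|] := rank_well rkR (v := v); first by rewrite -lt0n.
    by left; split=> // w; rewrite SE inE -leqNgt => le_w; apply: below; rewrite rk0 rkv.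
  by rewrite aboveE; right.
(* The minimizer [u] is at least as good as the image [u0] that exists by the greedy step. *)
have [u0 u0X pot0] := greedy_step A_sym A_irr label_of_sym label_of_irr label_of_le1
  (forest_edges A_sym A_irr A_acyclic) C_total f_inj vS order B_small B_deg pot.
have keyE x : x \in ~: (f @: S) -> (den n M1 (fun _ => x) (xembed_key 11))%:R
    = `|sample A C (v |: S) (extend f v x)|.
  by rewrite inE => xX; rewrite (den_xembed_key (i := x) R inM1 vS M1im L_irr M1cur M1v).
have uX' : u \in ~: (f @: S) by rewrite inE.
have card_next x : x \in ~: (f @: S) ->
    #|~: (extend f v x @: (v |: S))| = (n - i.+1)%N.
  by move=> xX; rewrite free_extend //; have := cardsD1 x (~: (f @: S)); rewrite xX Xcard add1n subnS => ->.
(* For the last vertex there is nothing left to sample and the keys say nothing, but only one image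
   is free. *)
have [n1|n1] := posnP (n - i.+1)%N.
  suff -> : u = u0 by [].
  have /card_le1_eqP : (#|~: (f @: S)| <= 1)%N.
    by rewrite Xcard leq_subLR addn1 -subn_eq0 n1.
  exact.
have := u_min u0; rewrite valK; move: (u0X); rewrite inE => u0X' /(_ u0X').
rewrite -(ler_nat R) !keyE //.
rewrite !(sampleE A_sym A_irr label_of_sym label_of_irr) ?card_next //; last 2 first.
- by apply: extend_inj.
- by apply: extend_inj.
rewrite !normrM normr_nat ler_pM2l => [le_u|]; first exact: le_trans le_u pot0.
by rewrite ltr0n; case: (n - i.+1)%N n1 => [|[|k]].
Qed.

Lemma embed_loop_correct M s : inputs L A M ->
  ranking A n (fun v : 'I_n => M ranks v) -> (forall i, M images i = 0%N) ->
  let M' := sden n embed_loop s M in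
  inputs L A M' /\ exists f : 'I_n -> 'I_n, [/\ injective f,
    forall z : 'I_n, M' images z = (f z).+1 & `|potential A C setT f| <= B].
Proof.
move=> inM rkR im0 /=; set rk := fun v : 'I_n => _ in rkR.
have : embedding rk n (sden n embed_loop s M).
  rewrite /embed_loop sden_for.
  apply: (iteri_ind (I := embedding rk)); last by move=> i M1 lt_in; exact: embed_step.
  split=> //; exists set0, id; split.
  - by apply/setP => v; rewrite !inE subn0 ltnNge (rank_le rkR).
  - by rewrite cards0.
  - by move=> ?; rewrite inE.
  - by move=> z; rewrite inE im0.
  - rewrite potential0 // normr0; apply: le_trans B_small; lra.
move=> [inM' _ [S [f [SE cardS f_inj Mim pot]]]]; split=> //.
have ST : S = setT by apply/eqP; rewrite eqEcard subsetT cardsT card_ord cardS /=.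
rewrite ST in f_inj Mim pot; exists f; split=> //.
- by move=> x y E; apply: f_inj; rewrite ?inE.
- by move=> z; have := Mim z; rewrite inE.
Qed.

End EmbedLoop.

(** * Writing the adjacency matrix of the copy *)

Definition output_loop : stmt :=
  SFor 10 (SFor 11 (SAssign 3 (XAdd (XSum 0 (XVar 10)) (XVar 11))
    (XSum 1 (XSum 2 (XIf (xand (xeq (ximg 1) (XAdd (XVar 10) (XConst 1)))
                              (xeq (ximg 2) (XAdd (XVar 11) (XConst 1))))
                      (xadj (XVar 1) (XVar 2)) (XConst 0)))))).

Section Output.

Variables (n : nat) (L A : rel 'I_n) (f : 'I_n -> 'I_n).
Hypothesis f_inj : injective f.

(** The inverse of [f] is not stored, so the preimages of [x] and [y] are found by search. *)
Let entry (x y : 'I_n) : nat :=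
  (\sum_(z < n) \sum_(w < n) if (f z == x) && (f w == y) then nat_of_bool (A z w) else 0)%N.

Lemma entry_image i j : entry (f i) (f j) = A i j.
Proof.
rewrite /entry (bigD1 i) //= [X in (_ + X)%N]big1 ?addn0 => [|z zi]; last first.
  by rewrite big1 // => w _; rewrite (inj_eq f_inj) (negbTE zi).
rewrite (bigD1 j) //= !eqxx big1 ?addn0 // => w wj.
by rewrite (inj_eq f_inj w) (negbTE wj) andbF.
Qed.

Definition writable (M : memory) : Prop :=
  inputs L A M /\ forall z : 'I_n, M images z = (f z).+1.

Lemma den_entry M (s : nat -> nat) (x y : 'I_n) : writable M -> s 10%N = x -> s 11%N = y ->
  den n M s (XSum 1 (XSum 2 (XIf (xand (xeq (ximg 1) (XAdd (XVar 10) (XConst 1)))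
                              (xeq (ximg 2) (XAdd (XVar 11) (XConst 1))))
                      (xadj (XVar 1) (XVar 2)) (XConst 0)))) = entry x y.
Proof.
move=> [inM im] sx sy; rewrite den_sum; apply: eq_bigr => z _.
rewrite den_sum; apply: eq_bigr => w _; rewrite den_if den_xand !den_xeq !nat_of_bool_neq0.
rewrite (den_xadj inM (i := z) (j := w)) //= !im /bind /= sx sy !addn1 !eqSS.
by rewrite !val_eqE.
Qed.

Lemma output_loop_correct M s : writable M ->
  forall i j : 'I_n, sden n output_loop s M 3%N (f i * n + f j)%N = A i j.
Proof.
move=> wM i j; rewrite /output_loop sden_for.
pose I a M' := writable M' /\ forall x y : 'I_n, (x < a)%N ->
  M' 3%N (x * n + y)%N = entry x y.
set M' := iteri _ _ M; suff [_ H] : I n M' by rewrite H ?entry_image.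
apply: (iteri_ind (I := I)) => [|a M1 lt_an [wM1 M1out]]; first by [].
rewrite sden_for.
pose J b M' := writable M' /\ forall x y : 'I_n, (x < a)%N || ((x == a :> nat) && (y < b)%N) ->
  M' 3%N (x * n + y)%N = entry x y.
set M2 := iteri _ _ M1; suff [wM2 M2out] : J n M2.
  by split=> // x y; rewrite ltnS leq_eqVlt => xa; apply: M2out; rewrite ltn_ord andbT orbC.
apply: (iteri_ind (I := J)) => [|b {}M2 lt_bn [wM2 M2out]].
  by split=> // x y; rewrite ltn0 andbF orbF; exact: M1out.
rewrite sden_assign.
rewrite (@den_entry _ _ (Ordinal lt_an) (Ordinal lt_bn)) //.
set k := den n M2 _ _.
have -> : k = (a * n + b)%N.
  by rewrite /k /= (eq_bigr (fun _ => a)) // sum_nat_const card_ord mulnC.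
split.
  by case: wM2 => inM2 im2; split=> [|z]; [exact: inputs_update|exact: im2].
move=> x y xy; rewrite /update eqxx /=; case: eqP => [E|ne].
  have [-> -> //] : x = Ordinal lt_an /\ y = Ordinal lt_bn.
  exact: (index_inj (i := x) (j := y) (i' := Ordinal lt_an) (j' := Ordinal lt_bn) E).
apply: M2out; move: xy; rewrite ltnS => /orP[->//|/andP[/eqP xa]].
rewrite xa ltnn eqxx /= leq_eqVlt => /orP[/eqP yb|//].
by rewrite xa yb in ne.
Qed.

End Output.

(** * Weights of copies *)

Lemma card_ordered_pairs (T : finType) (e : {set T}) : #|e| = 2%N ->
  #|[set p : T * T | [set p.1; p.2] == e]| = 2%N.
Proof.
move/eqP/cards2P=> [a [b [ab ->]]].
have -> : [set p : T * T | [set p.1; p.2] == [set a; b]] = [set (a, b); (b, a)].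
  apply/setP => -[x y]; rewrite !inE /=; apply/eqP/orP => [E|[]/eqP[-> ->] //]; last exact: setUC.
  have : x \in [set a; b] by rewrite -E set21.
  have : y \in [set a; b] by rewrite -E set22.
  have : a \in [set x; y] by rewrite E set21.
  have : b \in [set x; y] by rewrite E set22.
  rewrite !inE => bxy axy /orP[/eqP ya|/eqP yb] /orP[/eqP xa|/eqP xb].
  - by move: bxy; rewrite xa ya orbb eq_sym (negbTE ab).
  - by right; rewrite xb ya.
  - by left; rewrite xa yb.
  - by move: axy; rewrite xb yb orbb (negbTE ab).
by rewrite cards2 xpair_eqE negb_and ab.
Qed.

Lemma sum_ordered_pairs (R : pzRingType) (T : finType) (E : {set {set T}}) (g : {set T} -> R) :
  (forall e, e \in E -> #|e| = 2%N) ->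
  \sum_x \sum_y (if [set x; y] \in E then g [set x; y] else 0) = 2 * \sum_(e in E) g e.
Proof.
move=> E2; rewrite pair_bigA /= -big_mkcond /=.
rewrite (partition_big (fun p : T * T => [set p.1; p.2]) (mem E)) //= mulr_sumr.
apply: eq_bigr => e eE; rewrite (eq_bigl (fun p => p \in [set p : T * T | [set p.1; p.2] == e])).
  rewrite (eq_bigr (fun _ => g e)) => [|p]; last by rewrite inE => /eqP->.
  by rewrite sumr_const card_ordered_pairs ?E2 // mulr_natl.
by move=> p; rewrite inE; case: eqP => [->|]; rewrite ?andbF ?eE.
Qed.

Section Copy.

Variables (R : realFieldType) (n : nat) (c : {set 'I_n} -> int) (F : {set {set 'I_n}}).
Hypotheses (c_zero : zero_sum_labeling c) (F_forest : spanning_forest F).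

Definition labels : rel 'I_n := fun u v => (u != v) && (c [set u; v] == 1).

Lemma labels_sym : symmetric labels.
Proof. by move=> u v; rewrite /labels eq_sym setUC. Qed.

Lemma labels_irr : irreflexive labels.
Proof. by move=> u; rewrite /labels eqxx. Qed.

Lemma complete_edgesE (u v : 'I_n) : ([set u; v] \in complete_edges n) = (u != v).
Proof. by rewrite inE cards2 eqSS eqb1. Qed.

Lemma label_ofE (u v : 'I_n) : label_of R labels u v
  = if [set u; v] \in complete_edges n then (c [set u; v])%:~R else 0.
Proof.
rewrite /label_of /labels complete_edgesE; case: eqVneq => //= uv.
have [|->|->] := c_zero.1 [set u; v]; by rewrite ?complete_edgesE.
Qed.

Lemma sum_label_of : \sum_u \sum_v label_of R labels u v = 0.
Proof.
rewrite (eq_bigr (fun u => \sum_v if [set u; v] \in complete_edges n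
   then (c [set u; v])%:~R else 0)) => [|u _]; last by apply: eq_bigr => v _; exact: label_ofE.
rewrite (sum_ordered_pairs (fun e => (c e)%:~R)) => [|e]; last by rewrite inE => /eqP.
have := c_zero.2; rewrite /weight => /(congr1 (intmul (1 : R))).
by rewrite rmorph_sum /= => ->; rewrite mulr0.
Qed.

Lemma adj_sym : symmetric (adj F).
Proof. by move=> u v; rewrite /adj setUC. Qed.

Lemma adj_neq u v : adj F u v -> u != v.
Proof. by rewrite -complete_edgesE; exact: (subsetP F_forest.1). Qed.

Lemma adj_irr : irreflexive (adj F).
Proof. by move=> u; apply/negP => /adj_neq; rewrite eqxx. Qed.

Lemma deg_le_max_degree v : (deg_in (adj F) setT v <= max_degree F)%N.
Proof.
apply: leq_trans (leq_bigmax v); rewrite deg_inE.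
rewrite -(card_in_imset (f := fun w => [set v; w])).
  apply: subset_leq_card; apply/subsetP => e /imsetP[w]; rewrite !inE /= => vw ->.
  by rewrite inE set11 /= andbT.
move=> w1 w2; rewrite !inE /= => /adj_neq vw1 _ E.
have : w1 \in [set v; w2] by rewrite -E set22.
by rewrite !inE eq_sym (negbTE vw1) => /eqP.
Qed.

Variable f : 'I_n -> 'I_n.
Hypothesis f_inj : injective f.

Definition copy : {set {set 'I_n}} := [set f @: (e : {set 'I_n}) | e in F].

Lemma imset_pair u v : f @: [set u; v] = [set f u; f v].
Proof. by rewrite imsetU1 imset_set1. Qed.

Lemma adj_copy u v : adj copy (f u) (f v) = adj F u v.
Proof. by rewrite /adj -imset_pair mem_imset //; exact: imset_inj. Qed.

Lemma copy_isomorphic : isomorphic_copy F copy.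
Proof.
split.
  apply/subsetP => e /imsetP[e' /(subsetP F_forest.1)]; rewrite inE => e'2 ->.
  by rewrite inE card_imset.
by exists (perm f_inj) => u v; rewrite !permE adj_copy.
Qed.

(** By [potentialT] the right side is the final potential. *)
Lemma weight_copy :
  2 * (weight c copy)%:~R = \sum_u \sum_v (adj F u v)%:R * label_of R labels (f u) (f v).
Proof.
transitivity (\sum_u \sum_v
    if [set u; v] \in F then (c (f @: [set u; v]))%:~R else 0 : R).
  rewrite (sum_ordered_pairs (fun e : {set 'I_n} => (c (f @: e))%:~R)) => [|e /(subsetP F_forest.1)].
    rewrite /weight rmorph_sum /=; congr (_ * _); rewrite big_imset //= => e1 e2 _ _; exact: imset_inj.
  by rewrite inE => /eqP.
apply: eq_bigr => u _; apply: eq_bigr => v _; rewrite -/(adj F u v).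
case: ifP => [uv|_]; last by rewrite mul0r.
rewrite mul1r label_ofE imset_pair complete_edgesE (inj_eq f_inj) adj_neq //.
Qed.

End Copy.

(** * Assembling the program and its bounds *)

Theorem theorem1 (R : realType) (eps : R) (eps_gt0 : 0 < eps) :
  exists (C : R) (P : program),
    finds_copy_in_polynomial_time P
      (fun (n : nat) (c : {set 'I_n} -> int) (F F' : {set {set 'I_n}}) =>
         `|weight c F'|%:~R <= (3 / 4 + eps) * (max_degree F)%:R + C).
Proof.
pose p := SSeq rank_loop (SSeq embed_loop output_loop).
(* The potential is twice the weight, so the bound [B] on it is halved: 3/2 becomes 3/4, and the
   constant is half that of [B]. *)
exists ((8 * 1600 + 36) / 2), (scomp p), (stime p) => n c F c_zero F_forest.
have wf_p : swf [::] p by [].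
have in0 : inputs (labels c) (adj F) (input c F) by split=> // i j; exact: row_majorE.
have [t [m [ex le_t [m_den _]]]] := scomp_correct wf_p
  (erefl n : input c F 0%N 0%N = n) (fun a _ => frefl (input c F a)).
set s := input c F vars in m_den.
have := rank_loop_correct (adj_sym F) (adj_irr F_forest) F_forest.2 s in0
  (fun=> erefl) (fun=> erefl).
set M1 := sden n rank_loop s _ => -[in1 rkM1 im1].
pose B : R := 3 / 2 * (max_degree F)%:R + (8 * 1600 + 36).
have D0 : 0 <= (max_degree F)%:R :> R by rewrite ler0n.
have B_small : 8 * 1600 + 16 <= B by rewrite /B; lra.
have B_deg w : 3 / 2 * (deg_in (adj F) setT w)%:R + 36 <= B.
  have : (deg_in (adj F) setT w)%:R <= (max_degree F)%:R :> R.
    by rewrite ler_nat deg_le_max_degree.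
  rewrite /B; lra.
have [in2 [f [f_inj im2 pot]]] := embed_loop_correct (adj_sym F) (adj_irr F_forest)
  F_forest.2 (labels_sym c) (labels_irr c) (sum_label_of R c_zero) B_small B_deg s in1 rkM1 im1.
exists t, m, (copy F f); split=> //.
- move=> u v; rewrite m_den // /p !sden_seq -/M1.
  have fK x : exists y, x = f y.
    by have [g _ gK] := injF_bij f_inj; exists (g x); rewrite gK.
  have [u' ->] := fK u; have [v' ->] := fK v.
  by rewrite (output_loop_correct f_inj s (conj in2 im2)) adj_copy.
- exact: copy_isomorphic.
move: pot; rewrite potentialT -(weight_copy R c_zero F_forest f_inj) normrM intr_norm.
rewrite [`|2|]ger0_norm // /B => pot.
have : 0 <= eps * (max_degree F)%:R by rewrite mulr_ge0 // ltW.
by rewrite mulrDl; lra.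
Qed.
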